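(* Let $n\ge1$ be an integer, $\zeta=e^{2\pi i/n}$, and let $x,y\in\mathbb{C}$ satisfy $x-\zeta^jy\notin\{0,-1,-2,\ldots\}$ for $j=0,1,\ldots,n-1$. Then, with infinite products over $m$ understood as zeta-regularized products, $$\prod_{m=0}^\infty\left((m+x)^n-y^n\right)^{(-1)^m}=\prod_{m=0}^{\infty}\left(\prod_{j=0}^{n-1}(m+x-\zeta^jy)^{(-1)^m}\right)=\frac{\left(\sqrt{\pi/2}\right)^n}{\prod_{j=0}^{n-1}\tilde\Gamma(x-\zeta^jy)}.$$
   Context: Complex powers use the principal branch. For a sequence $(a_m)_{m\ge0}$ of nonzero complex numbers, the zeta-regularized product $\prod_{m=0}^\infty a_m^{(-1)^m}$ is $\exp(-F'(0))$, where $F(s)=\sum_{m=0}^\infty(-1)^ma_m^{-s}$ for $\mathrm{Re}(s)>0$, analytically continued to a neighbourhood of $s=0$ (existence of the continuation being part of the assertion); when $a_m$ is written as a finite product $\prod_jb_{m,j}$, $a_m^{-s}$ is read as $\prod_jb_{m,j}^{-s}$. The modified gamma function is $$\tilde\Gamma(x)=\frac1x e^{x\log 2}\prod_{m=1}^\infty\left(e^{-x/m}\left(1+\frac xm\right)\right)^{(-1)^{m+1}},\qquad x\in\mathbb{C}\setminus\{0,-1,-2,\ldots\},$$ with this last infinite product an ordinary convergent product. *)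

(* Defs.v *)
From Stdlib Require Export Reals.
From Coquelicot Require Export Coquelicot.

Open Scope C_scope.

Definition Cexp (z : C) : C :=
  (exp (Re z) * cos (Im z), exp (Re z) * sin (Im z))%R.

(** Values in (-PI, PI]; meaningful for [z <> 0] only. *)
Definition Carg (z : C) : R :=
  if Rle_dec 0 (Im z) then acos (Re z / Cmod z)
  else (- acos (Re z / Cmod z))%R.

Definition Clog (z : C) : C := (ln (Cmod z), Carg z).

(** Principal branch of [z ^ w], for [z <> 0]. *)
Definition Cpower (z w : C) : C := Cexp (w * Clog z).

Fixpoint Cprod (f : nat -> C) (n : nat) : C :=
  match n with
  | O => 1
  | S k => Cprod f k * f k
  end.

(** [alt_pow b m] is [b] raised to the power [(-1)^m]. *)
Definition alt_pow (b : C) (m : nat) : C := if Nat.even m then b else / b.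

(** Ordinary infinite product: the limit of the partial products. *)
Definition Cinf_prod (f : nat -> C) : C :=
  iota (T := C_CompleteNormedModule)
    (fun p => filterlim (fun N => Cprod f N) eventually (locally p)).

(** The product over [m >= 1] is re-indexed by [m = k + 1], so that
    [(-1)^(m+1) = (-1)^k]. *)
Definition mGamma (x : C) : C :=
  / x * Cexp (x * ln 2) *
  Cinf_prod (fun k =>
    alt_pow (Cexp (- (x / INR (S k))) * (1 + x / INR (S k))) k).

(** [p m s] stands for [a_m^(-s)]. The series converges to [F] on [Re s > 0],
    [F] is holomorphic there and on a disc around 0 (the union of these two sets
    is connected, so [F] is the analytic continuation of the sum), and
    [P = exp (- F'(0))]. *)
Definition is_alt_zeta_value (p : nat -> C -> C) (P : C) : Prop :=
  exists (F : C -> C) (eps : R) (d : C),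
    (0 < eps)%R /\
    (forall s : C, (0 < Re s)%R ->
       @is_series C_AbsRing C_NormedModule
         (fun m : nat => (- 1) ^ m * p m s) (F s)) /\
    (forall s : C, (0 < Re s)%R \/ (Cmod s < eps)%R ->
       @ex_derive C_AbsRing C_NormedModule F s) /\
    @is_derive C_AbsRing C_NormedModule F (RtoC 0) d /\
    P = Cexp (- d).

(** [P] is the zeta-regularized product of the [(a m)^((-1)^m)]. *)
Definition is_alt_zeta_prod (a : nat -> C) (P : C) : Prop :=
  (forall m, a m <> 0) /\
  is_alt_zeta_value (fun m s => Cpower (a m) (- s)) P.

(** The same for [a m] written as the product of the [b m j], [j < n]: here
    [a_m^(-s)] is read as the product of the [(b m j)^(-s)], which need not be
    the principal power of the product. *)
Definition is_alt_zeta_prod_factored (n : nat) (b : nat -> nat -> C) (P : C)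
  : Prop :=
  (forall m j, (j < n)%nat -> b m j <> 0) /\
  is_alt_zeta_value
    (fun m s => Cprod (fun j => Cpower (b m j) (- s)) n) P.

Definition zeta_root (n : nat) : C := Cexp (2 * PI * Ci / INR n).

(* Main.v *)
Require Import Defs.
From Stdlib Require Import Reals Lra Lia.
From Coquelicot Require Import Coquelicot.

(** Why the theorem is true. Put [z_j = x - zeta^j y], so that
    [(m + x)^n - y^n] is the product of the [m + z_j]
    ([pow_sub_pow_factor]), and let [L_m] be a logarithm of this number, either
    the sum of the principal logarithms of the factors or the principal
    logarithm of the product. Both series of the theorem have the form
    [F(s) = sum (-1)^m e^(-s L_m)]. All that matters about [L] is that
    [L_m - n ln (m+1)] tends to [0] and that the first and second differences of
    [L] are [O(1/m)] and [O(1/m^2)]; the two choices of [L] agree for large [m].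

    Continuation. Euler's transformation, applied twice, rewrites an alternating
    sum [sum (-1)^m u_m] as two boundary terms plus a quarter of
    [sum (-1)^m u''_m], where [u''] is the second difference. If [u_m] is of
    order [m^a], with each difference gaining one power of [m], the new series
    converges absolutely for [a < 1]. Sequences of this kind are stable under
    products, and [e^(-s L_m)] is one of them with [a = - n Re s], so the
    accelerated sum defines [F] on a half-plane containing [0]. Moreover
    [e^(-h L) - 1 + h L] is of this kind with a constant of order [|h|^2]: the
    accelerated sum of [e^(-s L)] times this remainder is the remainder of
    [F(s + h)] at first order, hence [F] is holomorphic and [- F'(0)] is the
    accelerated sum of [L] itself ([alt_zeta_value_of_log_growth]).

    Value. Along even indices, the accelerated sum of [L] is the limit of the
    partial sums corrected by [L_(2M) / 2]. Exponentiating,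
    [exp (- F'(0))] is the limit of [(2M+1)^(n/2)] times the alternating product
    of the first [2M] numbers [e^(L_m)] ([Clim_Wprod]). This depends neither on
    the choice of logarithms nor on the grouping of the factors, so both products
    of the theorem equal the product over [j] of the limits [P(z_j)] obtained in
    the same way from the single sequences [m + z_j].

    Gamma. The partial products defining [mGamma z], cut at an even index, are
    elementary multiples of the inverses of those for [P(z)] and [P(1)], and
    [1 - 1/2 + 1/3 - ... = ln 2] takes care of the exponential factors; hence
    [mGamma z = 1 / (P(z) P(1))] ([mGamma_eq]). Finally
    [P(1) = sqrt (2 / PI)] is Wallis' product ([shift_prod_1]). *)

Open Scope C_scope.
Set Bullet Behavior "Strict Subproofs".

(** * Limits of complex sequences *)

(** Convergence measured by the modulus; equivalent to convergence of the two
    components, on which the filters of the complex plane are based. *)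
Definition Clim (u : nat -> C) (l : C) : Prop :=
  is_lim_seq (fun n => Cmod (u n - l)) 0%R.

Lemma Cmod_le_Re_Im (z : C) : (Cmod z <= Rabs (Re z) + Rabs (Im z))%R.
Proof.
  replace z with (RtoC (Re z) + Ci * RtoC (Im z)) at 1.
  - eapply Rle_trans; [apply Cmod_triangle|].
    rewrite Cmod_mult, Cmod_Ci, !Cmod_R. lra.
  - destruct z as [a b]; apply injective_projections; simpl; ring.
Qed.

Lemma Im_le_Cmod (z : C) : (Rabs (Im z) <= Cmod z)%R.
Proof.
  eapply Rle_trans; [|apply (Rmax_Cmod z)]. apply Rmax_r.
Qed.

Lemma Cmod_sub_swap (a b : C) : Cmod (a - b) = Cmod (b - a).
Proof. rewrite <- Cmod_opp. f_equal. ring. Qed.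

Lemma Clim_squeeze (u : nat -> C) (l : C) (b : nat -> R) :
  (forall n, (Cmod (u n - l) <= b n)%R) -> is_lim_seq b 0%R -> Clim u l.
Proof.
  intros H Hb. unfold Clim.
  apply (is_lim_seq_le_le (fun _ => 0%R) _ b); auto.
  - intros n; split; auto. apply Cmod_ge_0.
  - apply is_lim_seq_const.
Qed.

Lemma Clim_ext_loc (u v : nat -> C) (l : C) :
  eventually (fun n => u n = v n) -> Clim u l -> Clim v l.
Proof.
  intros H Hu. eapply is_lim_seq_ext_loc; [|apply Hu].
  destruct H as [N H]; exists N; intros n Hn; now rewrite (H n Hn).
Qed.

Lemma Clim_ext (u v : nat -> C) (l : C) :
  (forall n, u n = v n) -> Clim u l -> Clim v l.
Proof. intros H; apply Clim_ext_loc; exists O; auto. Qed.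

Lemma Clim_const (l : C) : Clim (fun _ => l) l.
Proof.
  apply (Clim_squeeze _ _ (fun _ => 0%R)); [|apply is_lim_seq_const].
  intros n; replace (l - l) with (RtoC 0) by ring; rewrite Cmod_0; lra.
Qed.

Lemma Clim_plus (u v : nat -> C) (a b : C) :
  Clim u a -> Clim v b -> Clim (fun n => u n + v n) (a + b).
Proof.
  intros Hu Hv.
  apply (Clim_squeeze _ _ (fun n => Cmod (u n - a) + Cmod (v n - b))%R).
  - intros n; replace (u n + v n - (a + b)) with ((u n - a) + (v n - b)) by ring.
    apply Cmod_triangle.
  - replace (Finite 0) with (Finite (0 + 0)) by (f_equal; lra).
    now apply is_lim_seq_plus'.
Qed.

Lemma Clim_mult (u v : nat -> C) (a b : C) :
  Clim u a -> Clim v b -> Clim (fun n => u n * v n) (a * b).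
Proof.
  intros Hu Hv.
  apply (Clim_squeeze _ _ (fun n => Cmod (u n - a) * Cmod (v n - b)
    + Cmod a * Cmod (v n - b) + Cmod b * Cmod (u n - a))%R).
  - intros n.
    replace (u n * v n - a * b)
      with ((u n - a) * (v n - b) + a * (v n - b) + b * (u n - a)) by ring.
    rewrite <- !Cmod_mult.
    eapply Rle_trans; [apply Cmod_triangle|apply Rplus_le_compat_r].
    apply Cmod_triangle.
  - replace (Finite 0) with (Finite (0 * 0 + Cmod a * 0 + Cmod b * 0))
      by (f_equal; lra).
    repeat apply is_lim_seq_plus'; apply is_lim_seq_mult'; auto;
      apply is_lim_seq_const.
Qed.

Lemma Clim_scal (u : nat -> C) (c a : C) :
  Clim u a -> Clim (fun n => c * u n) (c * a).
Proof. intros; apply Clim_mult; [apply Clim_const|auto]. Qed.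

Lemma Clim_sub (u v : nat -> C) (a b : C) :
  Clim u a -> Clim v b -> Clim (fun n => u n - v n) (a - b).
Proof.
  intros Hu Hv.
  apply (Clim_ext (fun n => u n + (- (1)) * v n)); [intros; ring|].
  replace (a - b) with (a + (- (1)) * b) by ring.
  apply Clim_plus; auto. now apply Clim_scal.
Qed.

Lemma Clim_subseq (u : nat -> C) (l : C) (phi : nat -> nat) :
  filterlim phi eventually eventually ->
  Clim u l -> Clim (fun n => u (phi n)) l.
Proof. intros Hphi Hu. exact (is_lim_seq_subseq _ _ phi Hphi Hu). Qed.

Lemma Clim_Cmod_le (u : nat -> C) (l : C) (K : R) :
  Clim u l -> (forall n, (Cmod (u n) <= K)%R) -> (Cmod l <= K)%R.
Proof.
  intros Hu HK.
  assert (H : is_lim_seq (fun n => K + Cmod (u n - l))%R (K + 0)%R)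
    by (apply is_lim_seq_plus'; [apply is_lim_seq_const|exact Hu]).
  rewrite Rplus_0_r in H.
  refine (is_lim_seq_le _ _ _ _ _ (is_lim_seq_const (Cmod l)) H).
  intros n. replace l with (u n + (l - u n)) at 1 by ring.
  eapply Rle_trans; [apply Cmod_triangle|].
  rewrite (Cmod_sub_swap l). specialize (HK n); lra.
Qed.

Lemma Clim_unique (u : nat -> C) (a b : C) : Clim u a -> Clim u b -> a = b.
Proof.
  intros Ha Hb.
  apply Ceq_minus, Cmod_eq_0, Rle_antisym; [|apply Cmod_ge_0].
  apply (Clim_Cmod_le _ _ 0%R (Clim_sub _ _ _ _ Ha Hb)).
  intros n; replace (u n - u n) with (RtoC 0) by ring; rewrite Cmod_0; lra.
Qed.

Lemma Clim_bounded (u : nat -> C) (l : C) :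
  Clim u l -> exists K : R, forall n, (Cmod (u n) <= K)%R.
Proof.
  intros Hu.
  destruct (filterlim_bounded (fun n => Cmod (u n - l)) (ex_intro _ 0%R Hu))
    as [K HK].
  exists (K + Cmod l)%R; intros n.
  replace (u n) with ((u n - l) + l) by ring.
  eapply Rle_trans; [apply Cmod_triangle|apply Rplus_le_compat_r].
  specialize (HK n). apply (Rle_trans _ (Rabs (Cmod (u n - l)))); [apply Rle_abs|exact HK].
Qed.

Lemma Clim_RtoC (u : nat -> R) (l : R) :
  is_lim_seq u l -> Clim (fun n => RtoC (u n)) (RtoC l).
Proof.
  intros Hu. unfold Clim.
  apply (is_lim_seq_ext (fun n => Rabs (u n - l))).
  - intros n; now rewrite <- RtoC_minus, Cmod_R.
  - apply (is_lim_seq_abs_0 (fun n => u n - l)%R).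
    replace (Finite 0) with (Finite (l - l)) by (f_equal; lra).
    apply is_lim_seq_minus'; [exact Hu|apply is_lim_seq_const].
Qed.

Lemma Clim_incr (u : nat -> C) (l : C) :
  Clim u l -> Clim (fun n => u (S n)) l.
Proof. intros H. apply is_lim_seq_incr_1 in H. exact H. Qed.

Lemma Clim_even_odd (u : nat -> C) (l : C) :
  Clim (fun n => u (2 * n)%nat) l -> Clim (fun n => u (S (2 * n))) l ->
  Clim u l.
Proof.
  unfold Clim; intros He Ho.
  apply is_lim_seq_spec in He; apply is_lim_seq_spec in Ho.
  apply is_lim_seq_spec; intros eps.
  destruct (He eps) as [N HN]; destruct (Ho eps) as [M HM].
  exists (2 * N + 2 * M + 1)%nat; intros n Hn.
  destruct (Nat.Even_or_Odd n) as [[k ->]|[k ->]].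
  - apply HN; lia.
  - replace (2 * k + 1)%nat with (S (2 * k)) by lia. apply HM; lia.
Qed.

Lemma Clim_filterlim (u : nat -> C) (l : C) :
  Clim u l -> filterlim u eventually (locally (l : C_NormedModule)).
Proof.
  intros Hu. apply filterlim_locally; intros eps.
  apply is_lim_seq_spec in Hu. destruct (Hu eps) as [N HN].
  exists N; intros n Hn. apply (norm_compat1 (V := C_NormedModule)).
  specialize (HN n Hn). rewrite Rminus_0_r, Rabs_pos_eq in HN by apply Cmod_ge_0.
  exact HN.
Qed.

Lemma filterlim_Clim (u : nat -> C) (l : C) :
  filterlim u eventually (locally (l : C_NormedModule)) -> Clim u l.
Proof.
  intros Hu. apply is_lim_seq_spec; intros eps.
  assert (He : (0 < eps / 2)%R) by (destruct eps; simpl; lra).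
  pose proof (proj1 (filterlim_locally (U := C_UniformSpace) _ _) Hu (mkposreal _ He)) as [N HN].
  exists N; intros n Hn. rewrite Rminus_0_r, Rabs_pos_eq by apply Cmod_ge_0.
  destruct (HN n Hn) as [H1 H2].
  unfold ball in H1, H2; simpl in H1, H2; unfold AbsRing_ball, abs, minus, plus, opp in H1, H2; simpl in H1, H2.
  eapply Rle_lt_trans; [apply Cmod_le_Re_Im|].
  unfold Re, Im; simpl. 
  replace (pos eps) with (eps / 2 + eps / 2)%R by field.
  apply Rplus_lt_compat; assumption.
Qed.

(** * The complex exponential *)

Lemma Cexp_0 : Cexp 0 = 1.
Proof.
  unfold Cexp; simpl. rewrite exp_0, cos_0, sin_0.
  apply injective_projections; simpl; ring.
Qed.

Lemma Cexp_plus (z w : C) : Cexp (z + w) = Cexp z * Cexp w.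
Proof.
  destruct z as [a b], w as [c d]. unfold Cexp; simpl.
  rewrite exp_plus, cos_plus, sin_plus.
  apply injective_projections; simpl; ring.
Qed.

Lemma Cmod_Cexp (z : C) : Cmod (Cexp z) = exp (Re z).
Proof.
  unfold Cexp, Cmod; simpl.
  replace (_ + _)%R with (exp (Re z) ^ 2 * ((sin (Im z))² + (cos (Im z))²))%R
    by (unfold Rsqr; ring).
  rewrite sin2_cos2, Rmult_1_r. apply sqrt_pow2. left; apply exp_pos.
Qed.

Lemma Cexp_neq_0 (z : C) : Cexp z <> 0.
Proof. apply Cmod_gt_0. rewrite Cmod_Cexp. apply exp_pos. Qed.

Lemma Cexp_opp (z : C) : Cexp (- z) = / Cexp z.
Proof.
  assert (H := Cexp_plus z (- z)).
  rewrite Cplus_opp_r, Cexp_0 in H.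
  replace (/ Cexp z) with (/ Cexp z * (Cexp z * Cexp (- z)))
    by (rewrite <- H; ring).
  field. apply Cexp_neq_0.
Qed.

Lemma Cexp_RtoC (x : R) : Cexp (RtoC x) = RtoC (exp x).
Proof.
  unfold Cexp; simpl. rewrite cos_0, sin_0.
  apply injective_projections; simpl; ring.
Qed.

Lemma Cexp_nat_mult (k : nat) (z : C) : Cexp (INR k * z) = Cexp z ^ k.
Proof.
  induction k as [|k IH].
  - simpl. rewrite Cmult_0_l. apply Cexp_0.
  - rewrite S_INR, RtoC_plus, Cpow_S, <- IH, <- Cexp_plus. f_equal; ring.
Qed.

Definition Cexp_rem (z : C) : C := Cexp z - 1 - z.

Lemma Rabs_sin_le (x : R) : (Rabs (sin x) <= Rabs x)%R.
Proof.
  destruct (MVT_abs sin cos 0 x) as [c [H _]].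
  { intros; apply derivable_pt_lim_sin. }
  rewrite sin_0, !Rminus_0_r in H. rewrite H.
  rewrite <- (Rmult_1_l (Rabs x)) at 2.
  apply Rmult_le_compat_r; [apply Rabs_pos|].
  apply Rabs_le, COS_bound.
Qed.

Lemma one_sub_cos (x : R) : (1 - cos x = 2 * (sin (x / 2))²)%R.
Proof.
  replace x with (2 * (x / 2))%R at 1 by field.
  rewrite cos_2a_sin. unfold Rsqr. ring.
Qed.

Lemma Rabs_cos_sub_1_le (x : R) : (Rabs (cos x - 1) <= Rabs x)%R.
Proof.
  rewrite Rabs_minus_sym, one_sub_cos, Rsqr_abs.
  pose proof (Rabs_sin_le (x / 2)) as H.
  replace (Rabs (x / 2)) with (Rabs x / 2)%R in H
    by (unfold Rdiv; rewrite Rabs_mult; f_equal; rewrite Rabs_pos_eq; lra).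
  pose proof (Rabs_pos (sin (x / 2))).
  assert (Rabs (sin (x / 2)) <= 1)%R by apply Rabs_le, SIN_bound.
  rewrite Rabs_pos_eq by (unfold Rsqr; nra). unfold Rsqr; nra.
Qed.

Lemma Rabs_cos_sub_1_le_sqr (x : R) : (Rabs (cos x - 1) <= x * x)%R.
Proof.
  rewrite Rabs_minus_sym, one_sub_cos.
  pose proof (Rsqr_le_abs_1 _ _ (Rabs_sin_le (x / 2))) as H.
  rewrite Rabs_pos_eq by (pose proof (Rle_0_sqr (sin (x / 2))); lra).
  unfold Rsqr in *; nra.
Qed.

Lemma Rabs_sin_sub_le_sqr (x : R) : (Rabs (sin x - x) <= x * x)%R.
Proof.
  destruct (MVT_abs (fun t => sin t - t)%R (fun t => cos t - 1)%R 0 x)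
    as [c [H Hc]].
  { intros c _. apply derivable_pt_lim_minus;
      [apply derivable_pt_lim_sin|apply derivable_pt_lim_id]. }
  rewrite sin_0, !Rminus_0_r in H. rewrite H.
  assert (Hcx : (Rabs c <= Rabs x)%R).
  { unfold Rmin, Rmax in Hc; destruct (Rle_dec 0 x);
      unfold Rabs; destruct (Rcase_abs c), (Rcase_abs x); lra. }
  pose proof (Rabs_cos_sub_1_le c).
  pose proof (Rabs_pos (cos c - 1)). pose proof (Rabs_pos x).
  replace (x * x)%R with (Rabs x * Rabs x)%R
    by (rewrite <- Rabs_mult; apply Rabs_pos_eq; nra).
  apply Rmult_le_compat_r; lra.
Qed.

Lemma Rabs_exp_sub_1_le (x : R) : (Rabs (exp x - 1) <= Rabs x * exp (Rabs x))%R.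
Proof.
  pose proof (exp_ineq1_le x) as H1. pose proof (exp_ineq1_le (- x)) as H2.
  pose proof (exp_pos x) as H3.
  assert (H4 : (exp x * exp (- x) = 1)%R)
    by (rewrite <- exp_plus, Rplus_opp_r; apply exp_0).
  destruct (Rle_dec 0 x) as [Hx|Hx].
  - rewrite (Rabs_pos_eq x), Rabs_pos_eq by lra. nra.
  - rewrite (Rabs_left x) by lra.
    pose proof (exp_ineq1_le (- x)).
    rewrite Rabs_left1 by (rewrite <- exp_0; apply Rle_minus, Rlt_le, exp_increasing; lra). nra.
Qed.

Lemma Rabs_exp_rem_le (x : R) :
  (Rabs (exp x - 1 - x) <= x * x * exp (Rabs x))%R.
Proof.
  pose proof (exp_ineq1_le x) as H1. pose proof (exp_ineq1_le (- x)) as H2.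
  pose proof (exp_pos x) as H3.
  assert (H4 : (exp x * exp (- x) = 1)%R)
    by (rewrite <- exp_plus, Rplus_opp_r; apply exp_0).
  rewrite Rabs_pos_eq by lra.
  apply (Rle_trans _ (x * (exp x - 1))); [nra|].
  eapply Rle_trans; [apply Rle_abs|]. rewrite Rabs_mult.
  replace (x * x)%R with (Rabs x * Rabs x)%R
    by (rewrite <- Rabs_mult; apply Rabs_pos_eq; nra).
  rewrite Rmult_assoc. apply Rmult_le_compat_l; [apply Rabs_pos|].
  apply Rabs_exp_sub_1_le.
Qed.

Lemma exp_le_compat (x y : R) : (x <= y -> exp x <= exp y)%R.
Proof. intros [H| ->]; [left; now apply exp_increasing|lra]. Qed.

Lemma exp_Re_le (z : C) : (exp (Re z) <= exp (Cmod z))%R.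
Proof.
  apply exp_le_compat. eapply Rle_trans; [apply Rle_abs|apply re_le_Cmod].
Qed.

Lemma exp_Rabs_Re_le (z : C) : (exp (Rabs (Re z)) <= exp (Cmod z))%R.
Proof. apply exp_le_compat, re_le_Cmod. Qed.

Lemma Cmod_Cexp_sub_1_le (z : C) :
  (Cmod (Cexp z - 1) <= 3 * Cmod z * exp (Cmod z))%R.
Proof.
  eapply Rle_trans; [apply Cmod_le_Re_Im|].
  pose proof (exp_Re_le z). pose proof (exp_Rabs_Re_le z).
  pose proof (re_le_Cmod z). pose proof (Im_le_Cmod z).
  pose proof (Rabs_exp_sub_1_le (Re z)).
  pose proof (Rabs_cos_sub_1_le (Im z)). pose proof (Rabs_sin_le (Im z)).
  set (a := Re z) in *; set (b := Im z) in *.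
  replace (Re (Cexp z - 1))%R with ((exp a - 1) + exp a * (cos b - 1))%R
    by (unfold Cexp; simpl; fold a b; ring).
  replace (Im (Cexp z - 1))%R with (exp a * sin b)%R
    by (unfold Cexp; simpl; fold a b; ring).
  assert (Rabs ((exp a - 1) + exp a * (cos b - 1))
    <= Rabs (exp a - 1) + exp a * Rabs (cos b - 1))%R.
  { eapply Rle_trans; [apply Rabs_triang|].
    rewrite (Rabs_mult (exp a)), (Rabs_pos_eq (exp a)); [lra|left; apply exp_pos]. }
  rewrite (Rabs_mult (exp a)), (Rabs_pos_eq (exp a)) by (left; apply exp_pos).
  set (E := exp (Cmod z)) in *. set (M := Cmod z) in *.
  pose proof (exp_pos a). pose proof (exp_pos (Rabs a)).
  pose proof (Rabs_pos a). pose proof (Rabs_pos b).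
  pose proof (Rabs_pos (cos b - 1)). pose proof (Rabs_pos (sin b)).
  assert (Rabs a * exp (Rabs a) <= M * E)%R
    by (apply Rmult_le_compat; lra).
  assert (exp a * Rabs (cos b - 1) <= E * M)%R
    by (apply Rmult_le_compat; lra).
  assert (exp a * Rabs (sin b) <= E * M)%R
    by (apply Rmult_le_compat; lra).
  lra.
Qed.

Lemma Cmod_Cexp_rem_le (z : C) :
  (Cmod (Cexp_rem z) <= 4 * Cmod z ^ 2 * exp (Cmod z))%R.
Proof.
  eapply Rle_trans; [apply Cmod_le_Re_Im|].
  pose proof (exp_Re_le z). pose proof (exp_Rabs_Re_le z).
  pose proof (re_le_Cmod z). pose proof (Im_le_Cmod z).
  pose proof (Cmod2_alt z) as Hz.
  pose proof (Rabs_exp_sub_1_le (Re z)). pose proof (Rabs_exp_rem_le (Re z)).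
  pose proof (Rabs_cos_sub_1_le_sqr (Im z)). pose proof (Rabs_sin_le (Im z)).
  pose proof (Rabs_sin_sub_le_sqr (Im z)).
  pose proof (exp_ineq1_le (Cmod z)). pose proof (Cmod_ge_0 z).
  unfold Cexp_rem.
  set (a := Re z) in *; set (b := Im z) in *.
  replace (Re (Cexp z - 1 - z))%R
    with ((exp a - 1 - a) + exp a * (cos b - 1))%R
    by (unfold Cexp; simpl; fold a b; unfold a, Re; ring).
  replace (Im (Cexp z - 1 - z))%R
    with ((exp a - 1) * sin b + (sin b - b))%R
    by (unfold Cexp; simpl; fold a b; unfold b, Im; ring).
  assert (Rabs ((exp a - 1 - a) + exp a * (cos b - 1))
    <= Rabs (exp a - 1 - a) + exp a * Rabs (cos b - 1))%R.
  { eapply Rle_trans; [apply Rabs_triang|].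
    rewrite (Rabs_mult (exp a)), (Rabs_pos_eq (exp a)); [lra|left; apply exp_pos]. }
  assert (Rabs ((exp a - 1) * sin b + (sin b - b))
    <= Rabs (exp a - 1) * Rabs (sin b) + Rabs (sin b - b))%R.
  { eapply Rle_trans; [apply Rabs_triang|]. rewrite Rabs_mult. lra. }
  set (E := exp (Cmod z)) in *. set (M := Cmod z) in *.
  pose proof (exp_pos a). pose proof (exp_pos (Rabs a)).
  pose proof (Rabs_pos a). pose proof (Rabs_pos b).
  pose proof (Rabs_pos (cos b - 1)). pose proof (Rabs_pos (sin b)).
  pose proof (Rabs_pos (exp a - 1)).
  assert (a * a <= M ^ 2)%R by nra. assert (b * b <= M ^ 2)%R by nra.
  assert (a * a * exp (Rabs a) <= M ^ 2 * E)%R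
    by (apply Rmult_le_compat; nra).
  assert (exp a * Rabs (cos b - 1) <= E * M ^ 2)%R
    by (apply Rmult_le_compat; lra).
  assert (Rabs a * exp (Rabs a) <= M * E)%R
    by (apply Rmult_le_compat; lra).
  assert (Rabs (exp a - 1) * Rabs (sin b) <= (M * E) * M)%R
    by (apply Rmult_le_compat; lra).
  assert (b * b <= M ^ 2 * E)%R by nra.
  nra.
Qed.

Lemma Clim_Cexp (u : nat -> C) (l : C) :
  Clim u l -> Clim (fun n => Cexp (u n)) (Cexp l).
Proof.
  intros Hu.
  apply (Clim_squeeze _ _ (fun n =>
    exp (Re l) * (3 * Cmod (u n - l) * exp (Cmod (u n - l))))%R).
  - intros n.
    replace (Cexp (u n)) with (Cexp l * Cexp (u n - l))
      by (rewrite <- Cexp_plus; f_equal; ring).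
    replace (Cexp l * Cexp (u n - l) - Cexp l)
      with (Cexp l * (Cexp (u n - l) - 1)) by ring.
    rewrite Cmod_mult, Cmod_Cexp. apply Rmult_le_compat_l.
    + left; apply exp_pos.
    + apply Cmod_Cexp_sub_1_le.
  - replace (Finite 0) with (Finite (exp (Re l) * (3 * 0 * exp 0)))
      by (f_equal; ring).
    apply is_lim_seq_mult'; [apply is_lim_seq_const|].
    apply is_lim_seq_mult'.
    + apply is_lim_seq_mult'; [apply is_lim_seq_const|exact Hu].
    + apply (is_lim_seq_continuous exp); [|exact Hu].
      apply derivable_continuous_pt, derivable_pt_exp.
Qed.

(** * Sequences of power growth with two differences *)

Definition Cdiff (u : nat -> C) (m : nat) : C := u (S m) - u m.

(** A discrete analogue of the symbol classes of analysis, cut at order two: two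
    differences are what is needed to make second differences of sequences of
    order below [m] absolutely summable. *)
Definition symb (K a : R) (u : nat -> C) : Prop :=
  forall m : nat,
    (Cmod (u m) <= K * Rpower (INR (S m)) a /\
     Cmod (Cdiff u m) <= K * Rpower (INR (S m)) a / INR (S m) /\
     Cmod (Cdiff (Cdiff u) m) <= K * Rpower (INR (S m)) a / INR (S m) ^ 2)%R.

Lemma INR_S_ge_1 (m : nat) : (1 <= INR (S m))%R.
Proof. rewrite S_INR. pose proof (pos_INR m). lra. Qed.

Lemma inv_INR_S (m : nat) : (0 < / INR (S m) <= 1)%R.
Proof.
  pose proof (INR_S_ge_1 m). split; [apply Rinv_0_lt_compat; lra|].
  rewrite <- Rinv_1. apply Rinv_le_contravar; lra.
Qed.

Lemma Rpower_pos (x a : R) : (0 < Rpower x a)%R.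
Proof. apply exp_pos. Qed.

Lemma Cmod_plus_le (z w : C) (a b : R) :
  (Cmod z <= a -> Cmod w <= b -> Cmod (z + w) <= a + b)%R.
Proof. intros. eapply Rle_trans; [apply Cmod_triangle|lra]. Qed.

Lemma Cmod_mult_le (z w : C) (a b : R) :
  (Cmod z <= a -> Cmod w <= b -> Cmod (z * w) <= a * b)%R.
Proof.
  intros. rewrite Cmod_mult.
  apply Rmult_le_compat; auto using Cmod_ge_0.
Qed.

(** Leibniz' rule for differences. The differences of a product are written in
    terms of differences at the same index [m], so that no weight has to be
    compared at different indices; the coefficients of the second difference add
    up to [9]. *)
Lemma symb_mult (K K' a b : R) (u v : nat -> C) :
  symb K a u -> symb K' b v -> symb (9 * (K * K')) (a + b) (fun m => u m * v m).
Proof.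
  intros Hu Hv m.
  destruct (Hu m) as (Hu0 & Hu1 & Hu2); destruct (Hv m) as (Hv0 & Hv1 & Hv2).
  rewrite Rpower_plus.
  pose proof (inv_INR_S m) as [Hi0 Hi1].
  unfold Rdiv in *. rewrite <- !pow_inv in *.
  set (i := (/ INR (S m))%R) in *.
  set (U := (K * Rpower (INR (S m)) a)%R) in *.
  set (V := (K' * Rpower (INR (S m)) b)%R) in *.
  replace (9 * (K * K') * (Rpower (INR (S m)) a * Rpower (INR (S m)) b))%R
    with (9 * (U * V))%R by (unfold U, V; ring).
  assert (HU : (0 <= U)%R) by (eapply Rle_trans; [apply Cmod_ge_0|eauto]).
  assert (HV : (0 <= V)%R) by (eapply Rle_trans; [apply Cmod_ge_0|eauto]).
  assert (HUV : (0 <= U * V)%R) by (apply Rmult_le_pos; auto).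
  assert (Hi2 : (0 <= i ^ 2 <= i)%R) by nra.
  assert (Hi3 : (0 <= i ^ 3 <= i ^ 2)%R) by nra.
  assert (Hi4 : (0 <= i ^ 4 <= i ^ 2)%R) by nra.
  split; [|split].
  - eapply Rle_trans; [apply (Cmod_mult_le _ _ _ _ Hu0 Hv0)|lra].
  - replace (Cdiff (fun n => u n * v n) m)
      with (u m * Cdiff v m + Cdiff u m * v m + Cdiff u m * Cdiff v m)
      by (unfold Cdiff; ring).
    eapply Rle_trans.
    { apply Cmod_plus_le; [apply Cmod_plus_le|]; apply Cmod_mult_le; eassumption. }
    replace (U * (V * i) + U * i * V + U * i * (V * i))%R
      with (U * V * (2 * i + i ^ 2))%R by ring.
    replace (9 * (U * V) * i)%R with (U * V * (9 * i))%R by ring.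
    apply Rmult_le_compat_l; lra.
  - replace (Cdiff (Cdiff (fun n => u n * v n)) m)
      with (u m * Cdiff (Cdiff v) m + Cdiff (Cdiff u) m * v m
        + 2 * (Cdiff u m * Cdiff v m + Cdiff u m * Cdiff (Cdiff v) m
          + Cdiff (Cdiff u) m * Cdiff v m)
        + Cdiff (Cdiff u) m * Cdiff (Cdiff v) m)
      by (unfold Cdiff; ring).
    eapply Rle_trans.
    { apply Cmod_plus_le; [apply Cmod_plus_le; [apply Cmod_plus_le|]|].
      1,2,4: apply Cmod_mult_le; eassumption.
      apply Cmod_mult_le; [rewrite Cmod_R; apply Rle_refl|].
      apply Cmod_plus_le; [apply Cmod_plus_le|]; apply Cmod_mult_le; eassumption. }
    rewrite (Rabs_pos_eq 2) by lra.
    match goal with |- (?l <= _)%R =>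
      replace l with (U * V * (4 * i ^ 2 + 4 * i ^ 3 + i ^ 4))%R by ring end.
    replace (9 * (U * V) * i ^ 2)%R with (U * V * (9 * i ^ 2))%R by ring.
    apply Rmult_le_compat_l; lra.
Qed.

Lemma symb_weaken (K a b : R) (u : nat -> C) :
  (a <= b)%R -> symb K a u -> symb K b u.
Proof.
  intros Hab Hu m. destruct (Hu m) as (H0 & H1 & H2).
  assert (HK : (0 <= K)%R).
  { pose proof (Cmod_ge_0 (u m)). pose proof (Rpower_pos (INR (S m)) a). nra. }
  assert (HW : (K * Rpower (INR (S m)) a <= K * Rpower (INR (S m)) b)%R).
  { apply Rmult_le_compat_l; auto. apply Rle_Rpower; auto. apply INR_S_ge_1. }
  pose proof (INR_S_ge_1 m) as Hx.
  unfold Rdiv in *; repeat split; (eapply Rle_trans; [eassumption|]); auto;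
    apply Rmult_le_compat_r; auto; left; apply Rinv_0_lt_compat; nra.
Qed.

Lemma is_lim_seq_INR_S : is_lim_seq (fun m => INR (S m)) p_infty.
Proof. apply (is_lim_seq_incr_1 INR), is_lim_seq_INR. Qed.

Lemma is_lim_seq_inv_INR_S : is_lim_seq (fun m => / INR (S m))%R 0%R.
Proof.
  replace (Finite 0) with (Rbar_inv p_infty) by reflexivity.
  apply is_lim_seq_inv; [apply is_lim_seq_INR_S|discriminate].
Qed.

Lemma is_lim_seq_ln_INR_S : is_lim_seq (fun m => ln (INR (S m))) p_infty.
Proof.
  apply (filterlim_comp _ _ _ (fun m => INR (S m)) ln _ (Rbar_locally' p_infty)).
  - apply is_lim_seq_INR_S.
  - apply is_lim_ln_p.
Qed.

Lemma is_lim_seq_Rpower_neg (a : R) :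
  (a < 0)%R -> is_lim_seq (fun m => Rpower (INR (S m)) a) 0%R.
Proof.
  intros Ha.
  apply (filterlim_comp _ _ _ (fun m => a * ln (INR (S m)))%R exp _
    (Rbar_locally' m_infty)).
  - assert (H := is_lim_seq_scal_l _ a _ is_lim_seq_ln_INR_S).
    replace (Rbar_mult a p_infty) with m_infty in H; [exact H|].
    simpl. destruct (Rle_dec 0 a); [exfalso; lra|reflexivity].
  - apply is_lim_exp_m.
Qed.

Lemma symb_lim_0 (K a : R) (u : nat -> C) :
  (a < 0)%R -> symb K a u -> Clim u 0.
Proof.
  intros Ha Hu.
  apply (Clim_squeeze _ _ (fun m => K * Rpower (INR (S m)) a)%R).
  - intros m. replace (u m - 0) with (u m) by ring. apply Hu.
  - replace (Finite 0) with (Finite (K * 0)) by (f_equal; ring).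
    apply is_lim_seq_mult'; [apply is_lim_seq_const|].
    now apply is_lim_seq_Rpower_neg.
Qed.

(** * Accelerated alternating sums *)

Fixpoint alt_sum (u : nat -> C) (N : nat) : C :=
  match N with
  | O => 0
  | S k => alt_sum u k + (-1) ^ k * u k
  end.

(** The last term averages out the oscillation of the partial sums to second
    order; Euler's transformation applied twice. *)
Definition alt_corr (u : nat -> C) (N : nat) : C :=
  alt_sum u N + (-1) ^ N * (u N / 2 - Cdiff u N / 4).

(** A linear summation method, assigning a value to [sum (-1)^m u_m] also for
    sequences [u] growing slower than [m]. *)
Definition is_altsum (u : nat -> C) (l : C) : Prop := Clim (alt_corr u) l.

(** Euler's transformation: the corrected partial sums are, up to boundary terms,
    the partial sums of the alternating series of second differences. *)
Lemma alt_corr_summed (u : nat -> C) (N : nat) :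
  alt_corr u N
  = u O / 2 - Cdiff u O / 4 + alt_sum (Cdiff (Cdiff u)) N / 4.
Proof.
  unfold alt_corr. induction N as [|N IH].
  - simpl. field.
  - simpl alt_sum.
    replace (u O / 2 - Cdiff u O / 4
      + (alt_sum (Cdiff (Cdiff u)) N + (-1) ^ N * Cdiff (Cdiff u) N) / 4)
      with ((u O / 2 - Cdiff u O / 4 + alt_sum (Cdiff (Cdiff u)) N / 4)
        + (-1) ^ N * Cdiff (Cdiff u) N / 4)
      by field.
    rewrite <- IH. unfold Cdiff. rewrite Cpow_S.
    field.
Qed.

Lemma Cmod_sign (m : nat) : Cmod ((-1) ^ m) = 1%R.
Proof. rewrite Cmod_pow, Cmod_R, Rabs_m1. apply pow1. Qed.

(** Makes [sum m^(-3/2)] converge by telescoping. *)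
Lemma sqrt_telescope (x : R) : (1 < x)%R ->
  (sqrt x / x ^ 2 <= 2 / sqrt (x - 1) - 2 / sqrt x)%R.
Proof.
  intros Hx.
  pose proof (sqrt_lt_R0 x ltac:(lra)) as Hs.
  pose proof (sqrt_lt_R0 (x - 1) ltac:(lra)) as Ht.
  pose proof (sqrt_sqrt x ltac:(lra)) as Hss.
  pose proof (sqrt_sqrt (x - 1) ltac:(lra)) as Htt.
  set (s := sqrt x) in *; set (t := sqrt (x - 1)) in *.
  assert (Hts : (t < s)%R) by nra.
  rewrite <- Hss.
  replace (s / (s * s) ^ 2)%R with (/ (s * (s * s)))%R by (field; lra).
  replace (2 / t - 2 / s)%R with (2 * (s - t) / (s * t))%R by (field; lra).
  replace (s - t)%R with (/ (s + t))%R.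
  2:{ apply Rmult_eq_reg_r with (s + t)%R; [|lra]. rewrite Rinv_l by lra. nra. }
  replace (2 * / (s + t) / (s * t))%R with (/ (s * (t * ((s + t) / 2))))%R
    by (field; lra).
  apply Rinv_le_contravar; [|]; repeat apply Rmult_lt_0_compat; try lra.
  apply Rmult_le_compat_l; [lra|]. apply Rmult_le_compat; lra.
Qed.

Lemma sum_sqrt_bound (n : nat) :
  (sum_n (fun m => Rpower (INR (S m)) (/ 2) / INR (S m) ^ 2) n
   <= 3 - 2 / sqrt (INR (S n)))%R.
Proof.
  induction n as [|n IH].
  - rewrite sum_O. simpl. rewrite Rpower_sqrt, sqrt_1; lra.
  - rewrite sum_Sn. unfold plus; simpl plus.
    rewrite Rpower_sqrt by (pose proof (INR_S_ge_1 (S n)); lra).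
    assert (H := sqrt_telescope (INR (S (S n)))).
    replace (INR (S (S n)) - 1)%R with (INR (S n)) in H
      by (rewrite (S_INR (S n)); ring).
    specialize (H ltac:(rewrite (S_INR (S n)); pose proof (INR_S_ge_1 n); lra)).
    apply (Rle_trans _ (3 - 2 / sqrt (INR (S n))
      + sqrt (INR (S (S n))) / INR (S (S n)) ^ 2)); [|lra].
    apply Rplus_le_compat_r. exact IH.
Qed.

Lemma sum_sqrt_le_3 (n : nat) :
  (sum_n (fun m => Rpower (INR (S m)) (/ 2) / INR (S m) ^ 2) n <= 3)%R.
Proof.
  eapply Rle_trans; [apply sum_sqrt_bound|].
  pose proof (sqrt_lt_R0 (INR (S n))) as H.
  specialize (H ltac:(pose proof (INR_S_ge_1 n); lra)).
  pose proof (Rinv_0_lt_compat _ H). lra.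
Qed.

Lemma ex_series_sqrt :
  ex_series (fun m => Rpower (INR (S m)) (/ 2) / INR (S m) ^ 2)%R.
Proof.
  edestruct ex_finite_lim_seq_incr as [l Hl]; [|apply sum_sqrt_le_3|exists l; exact Hl].
  intros n. rewrite sum_Sn. unfold plus; simpl plus.
  assert (0 <= Rpower (INR (S (S n))) (/ 2) / INR (S (S n)) ^ 2)%R;
    [|simpl AbelianMonoid.sort in *; unfold AbelianMonoid.sort in *; simpl in *; lra].
  left. apply Rdiv_lt_0_compat; [apply Rpower_pos|].
  pose proof (INR_S_ge_1 (S n)). nra.
Qed.

Lemma sum_n_alt_sum (u : nat -> C) (n : nat) :
  sum_n (G := C_NormedModule) (fun m => (-1) ^ m * u m) n = alt_sum u (S n).
Proof.
  induction n as [|n IH].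
  - rewrite sum_O. simpl. ring.
  - rewrite sum_Sn, IH. reflexivity.
Qed.

Lemma alt_sum_le (K : R) (w : nat -> C) (N : nat) :
  (0 <= K)%R ->
  (forall m, Cmod (w m) <= K * Rpower (INR (S m)) (/ 2) / INR (S m) ^ 2)%R ->
  (Cmod (alt_sum w N) <= 3 * K)%R.
Proof.
  intros HK Hw.
  destruct N as [|N]; [simpl; rewrite Cmod_0; lra|].
  apply (Rle_trans _
    (K * sum_n (fun m => Rpower (INR (S m)) (/ 2) / INR (S m) ^ 2) N)%R).
  - assert (Hm : forall m, (Cmod ((-1) ^ m * w m)
      <= K * (Rpower (INR (S m)) (/ 2) / INR (S m) ^ 2))%R).
    { intros m. rewrite Cmod_mult, Cmod_sign, Rmult_1_l.
      eapply Rle_trans; [apply Hw|]. right; unfold Rdiv; ring. }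
    induction N as [|N IH].
    + rewrite sum_O. simpl alt_sum. rewrite Cplus_0_l. exact (Hm O).
    + rewrite sum_Sn. unfold plus; simpl plus. rewrite Rmult_plus_distr_l.
      change (alt_sum w (S (S N)))
        with (alt_sum w (S N) + (-1) ^ S N * w (S N)).
      apply Cmod_plus_le; auto.
  - rewrite (Rmult_comm 3). apply Rmult_le_compat_l; auto using sum_sqrt_le_3.
Qed.

(** Growth below the first power is enough because the second differences are
    then absolutely summable; the bound on the value is what makes the sum of a
    Taylor remainder again a remainder. *)
Lemma altsum_symb (K : R) (u : nat -> C) :
  symb K (/ 2) u -> exists l, is_altsum u l /\ (Cmod l <= 2 * K)%R.
Proof.
  intros Hu.
  assert (Hu0 := Hu O). rewrite Rpower_sqrt in Hu0 by (simpl; lra).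
  simpl INR in Hu0. rewrite sqrt_1 in Hu0. destruct Hu0 as (H0 & H1 & _).
  assert (HK : (0 <= K)%R) by (pose proof (Cmod_ge_0 (u O)); lra).
  assert (Hs : ex_series (V := C_CompleteNormedModule)
    (fun m => (-1) ^ m * Cdiff (Cdiff u) m)).
  { apply (ex_series_le (V := C_CompleteNormedModule) _
      (fun m => K * (Rpower (INR (S m)) (/ 2) / INR (S m) ^ 2))%R).
    - intros m. change (Cmod ((-1) ^ m * Cdiff (Cdiff u) m)
        <= K * (Rpower (INR (S m)) (/ 2) / INR (S m) ^ 2))%R.
      rewrite Cmod_mult, Cmod_sign, Rmult_1_l.
      eapply Rle_trans; [apply Hu|]. right; unfold Rdiv; ring.
    - exact (ex_series_scal_l K _ ex_series_sqrt). }
  destruct Hs as [S HS].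
  assert (Hl : Clim (alt_sum (Cdiff (Cdiff u))) S).
  { apply is_lim_seq_incr_1.
    eapply is_lim_seq_ext; [|exact (filterlim_Clim _ _ HS)].
    intros n. cbv beta. now rewrite sum_n_alt_sum. }
  exists (u O / 2 - Cdiff u O / 4 + S / 4).
  assert (Ha : is_altsum u (u O / 2 - Cdiff u O / 4 + S / 4)).
  { eapply Clim_ext; [intros n; symmetry; apply alt_corr_summed|].
    apply Clim_plus; [apply Clim_const|].
    apply Clim_mult; [auto|apply Clim_const]. }
  split; [exact Ha|].
  apply (Clim_Cmod_le _ _ _ Ha). intros n. rewrite alt_corr_summed.
  assert (H2 : Cmod (/ RtoC 2) = (/ 2)%R)
    by (rewrite <- RtoC_inv, Cmod_R by lra; apply Rabs_pos_eq; lra).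
  assert (H4 : Cmod (/ RtoC 4) = (/ 4)%R)
    by (rewrite <- RtoC_inv, Cmod_R by lra; apply Rabs_pos_eq; lra).
  eapply Rle_trans; [apply Cmod_triangle|].
  eapply Rle_trans; [apply Rplus_le_compat_r, Cmod_triangle|].
  unfold Cdiv. rewrite Cmod_opp, !Cmod_mult, H2, H4.
  assert (H5 := alt_sum_le K (Cdiff (Cdiff u)) n HK (fun m => proj2 (proj2 (Hu m)))).
  lra.
Qed.

Lemma is_altsum_unique (u : nat -> C) (a b : C) :
  is_altsum u a -> is_altsum u b -> a = b.
Proof. apply Clim_unique. Qed.

Lemma alt_sum_lin (u v : nat -> C) (c : C) (N : nat) :
  alt_sum (fun m => u m + c * v m) N = alt_sum u N + c * alt_sum v N.
Proof. induction N as [|N IH]; simpl; [ring|rewrite IH; ring]. Qed.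

Lemma is_altsum_lin (u v : nat -> C) (c a b : C) :
  is_altsum u a -> is_altsum v b ->
  is_altsum (fun m => u m + c * v m) (a + c * b).
Proof.
  intros Hu Hv.
  apply (Clim_ext (fun N => alt_corr u N + c * alt_corr v N)).
  - intros N. unfold alt_corr. rewrite alt_sum_lin. unfold Cdiff, Cdiv. ring.
  - apply Clim_plus; [|apply Clim_scal]; assumption.
Qed.

Lemma is_altsum_ext (u v : nat -> C) (a : C) :
  (forall m, u m = v m) -> is_altsum u a -> is_altsum v a.
Proof.
  intros H. apply Clim_ext. intros N. unfold alt_corr, Cdiff. rewrite !H.
  f_equal. induction N as [|N IH]; simpl; [auto|now rewrite IH, H].
Qed.

(** Regularity of the summation method: the correction terms vanish in the
    limit, so the value is the ordinary sum. *)
Lemma altsum_is_series (u : nat -> C) (l : C) :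
  Clim u 0 -> is_altsum u l ->
  @is_series C_AbsRing C_NormedModule (fun m => (-1) ^ m * u m) l.
Proof.
  intros H0 Hl. apply (Clim_filterlim _ l).
  apply (Clim_ext (fun n => alt_sum u (S n)));
    [intros n; symmetry; apply sum_n_alt_sum|].
  apply (Clim_incr (alt_sum u)).
  apply (Clim_ext (fun N =>
    alt_corr u N - (-1) ^ N * (u N / 2 - Cdiff u N / 4))).
  { intros N; unfold alt_corr; ring. }
  replace l with (l - 0) by ring. apply Clim_sub; [exact Hl|].
  assert (Hd : Clim (fun N => u N / 2 - Cdiff u N / 4) 0).
  { replace (RtoC 0) with (0 * / 2 - (0 - 0) * / 4) by ring.
    apply Clim_sub; (apply Clim_mult; [|apply Clim_const]); [exact H0|].
    apply Clim_sub; [now apply Clim_incr|exact H0]. }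
  eapply is_lim_seq_ext; [|exact Hd]. intros N; cbv beta.
  set (d := u N / 2 - Cdiff u N / 4).
  replace ((-1) ^ N * d - 0) with ((-1) ^ N * (d - 0)) by ring.
  now rewrite Cmod_mult, Cmod_sign, Rmult_1_l.
Qed.

(** * Zeta-regularization of logarithmically growing sequences *)

(** Only the second and third bounds are of symbol type; the first one, being
    relative to [c ln (m + 1)] and not to a power, is what gives
    [e^(t L)] the exact order [m^(c Re t)]. *)
Definition log_growth (c K : R) (L : nat -> C) : Prop :=
  forall m : nat,
    (Cmod (L m - RtoC (c * ln (INR (S m)))) <= K /\
     Cmod (Cdiff L m) <= K / INR (S m) /\
     Cmod (Cdiff (Cdiff L) m) <= K / INR (S m) ^ 2)%R.

Lemma log_growth_nonneg (c K : R) (L : nat -> C) :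
  log_growth c K L -> (0 <= K)%R.
Proof. intros H. eapply Rle_trans; [apply Cmod_ge_0|apply (H O)]. Qed.

Lemma ln_INR_S_nonneg (m : nat) : (0 <= ln (INR (S m)))%R.
Proof.
  rewrite <- ln_1. destruct (INR_S_ge_1 m) as [H| <-]; [|lra].
  left. apply ln_increasing; lra.
Qed.

Lemma Cexp_differences (t : C) (L : nat -> C) (m : nat) :
  Cdiff (fun k => Cexp (t * L k)) m
    = Cexp (t * L m) * (Cexp (t * Cdiff L m) - 1) /\
  Cdiff (Cdiff (fun k => Cexp (t * L k))) m
    = Cexp (t * L m)
      * (Cexp_rem (t * (2 * Cdiff L m + Cdiff (Cdiff L) m))
         - 2 * Cexp_rem (t * Cdiff L m) + t * Cdiff (Cdiff L) m).
Proof.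
  assert (H1 : Cexp (t * L (S m)) = Cexp (t * L m) * Cexp (t * Cdiff L m)).
  { rewrite <- Cexp_plus. f_equal. unfold Cdiff. ring. }
  assert (H2 : Cexp (t * L (S (S m)))
    = Cexp (t * L m) * Cexp (t * (2 * Cdiff L m + Cdiff (Cdiff L) m))).
  { rewrite <- Cexp_plus. f_equal. unfold Cdiff. ring. }
  split.
  - unfold Cdiff at 1. rewrite H1. ring.
  - unfold Cdiff at 1 2. rewrite H2, H1. unfold Cexp_rem. ring.
Qed.

(** Each term carries two factors [t], from a remainder or from the product of
    [t * Cdiff L] with [e^(t L) - 1]. *)
Lemma Cexp_rem_differences (t : C) (L : nat -> C) (m : nat) :
  Cdiff (fun k => Cexp_rem (t * L k)) m
    = Cexp (t * L m) * Cexp_rem (t * Cdiff L m)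
      + t * Cdiff L m * (Cexp (t * L m) - 1) /\
  Cdiff (Cdiff (fun k => Cexp_rem (t * L k))) m
    = Cexp (t * L m)
      * (Cexp_rem (t * (2 * Cdiff L m + Cdiff (Cdiff L) m))
         - 2 * Cexp_rem (t * Cdiff L m))
      + t * Cdiff (Cdiff L) m * (Cexp (t * L m) - 1).
Proof.
  destruct (Cexp_differences t L m) as [H1 H2].
  split.
  - transitivity (Cdiff (fun k => Cexp (t * L k)) m - t * Cdiff L m);
      [unfold Cdiff, Cexp_rem; ring|].
    rewrite H1. unfold Cexp_rem. ring.
  - transitivity (Cdiff (Cdiff (fun k => Cexp (t * L k))) m
      - t * Cdiff (Cdiff L) m); [unfold Cdiff, Cexp_rem; ring|].
    rewrite H2. ring.
Qed.

Lemma Cmod_Cexp_rem_scal_le (t z : C) (T B : R) :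
  (Cmod t <= T)%R -> (Cmod z <= B)%R ->
  (Cmod (Cexp_rem (t * z)) <= 4 * (Cmod t ^ 2 * B ^ 2) * exp (T * B))%R.
Proof.
  intros Ht Hz. eapply Rle_trans; [apply Cmod_Cexp_rem_le|].
  rewrite Cmod_mult, Rpow_mult_distr.
  pose proof (Cmod_ge_0 t). pose proof (Cmod_ge_0 z).
  apply Rmult_le_compat.
  - pose proof (pow_le _ 2 H). pose proof (pow_le _ 2 H0). nra.
  - left; apply exp_pos.
  - apply Rmult_le_compat_l; [lra|].
    apply Rmult_le_compat_l; [apply pow_le; auto|]. apply pow_incr; lra.
  - apply exp_le_compat, Rmult_le_compat; auto.
Qed.

(** Since [Im L] is bounded, the order is governed by [Re t] alone. The bound on
    the second difference uses that the first-order terms cancel, leaving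
    [t * Cdiff (Cdiff L)] and remainders quadratic in [Cdiff L]. *)
Lemma symb_Cexp (c K : R) (L : nat -> C) (t : C) :
  log_growth c K L -> exists K', symb K' (c * Re t) (fun m => Cexp (t * L m)).
Proof.
  intros HL. pose proof (log_growth_nonneg _ _ _ HL) as HK.
  pose proof (Cmod_ge_0 t) as HT. set (T := Cmod t) in *.
  set (E := exp (T * K)).
  set (E3 := exp (T * (3 * K))).
  set (B := (1 + 3 * (T * K) * E + (12 * (T ^ 2 * (3 * K) ^ 2) * E3 + T * K))%R).
  assert (HE : (0 < E)%R) by apply exp_pos.
  assert (HE3 : (0 < E3)%R) by apply exp_pos.
  assert (HTK : (0 <= T * K)%R) by nra.
  assert (HTK2 : (0 <= T ^ 2 * (3 * K) ^ 2)%R) by nra.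
  assert (Hp1 : (0 <= 3 * (T * K) * E)%R) by nra.
  assert (Hp2 : (0 <= 12 * (T ^ 2 * (3 * K) ^ 2) * E3)%R) by nra.
  exists (E * B)%R. intros m.
  destruct (HL m) as (H0 & H1 & H2).
  pose proof (inv_INR_S m) as [Hi0 Hi1].
  unfold Rdiv in *. rewrite <- !pow_inv in *.
  set (i := (/ INR (S m))%R) in *.
  set (W := Rpower (INR (S m)) (c * Re t)).
  assert (HW : (0 < W)%R) by apply Rpower_pos.
  assert (Hu : (Cmod (Cexp (t * L m)) <= E * W)%R).
  { rewrite Cmod_Cexp. unfold E, W, Rpower. rewrite <- exp_plus.
    apply exp_le_compat.
    replace (t * L m) with (t * (L m - RtoC (c * ln (INR (S m))))
      + RtoC (c * ln (INR (S m))) * t) by ring.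
    rewrite re_plus, re_scal_l.
    assert (Re (t * (L m - RtoC (c * ln (INR (S m))))) <= T * K)%R; [|lra].
    eapply Rle_trans; [apply Rle_abs|]. eapply Rle_trans; [apply re_le_Cmod|].
    now apply Cmod_mult_le; [apply Rle_refl|]. }
  assert (HD : (Cmod (Cdiff L m) <= K)%R) by nra.
  assert (Hrem : forall d e, (Cmod d <= e * i)%R -> (0 <= e <= 3 * K)%R ->
    (Cmod (Cexp_rem (t * d)) <= 4 * (T ^ 2 * (3 * K) ^ 2) * E3 * i ^ 2)%R).
  { intros d e Hd He.
    eapply Rle_trans; [apply (Cmod_Cexp_rem_scal_le t d T (3 * K * i));
      [apply Rle_refl|nra]|].
    fold T. rewrite !Rpow_mult_distr.
    replace (4 * (T ^ 2 * (3 ^ 2 * K ^ 2)) * E3 * i ^ 2)%R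
      with (4 * (T ^ 2 * (3 ^ 2 * K ^ 2 * i ^ 2)) * E3)%R by ring.
    apply Rmult_le_compat_l.
    - replace (4 * (T ^ 2 * (3 ^ 2 * K ^ 2 * i ^ 2)))%R
        with (4 * (T * 3 * K * i) ^ 2)%R by ring.
      pose proof (pow2_ge_0 (T * 3 * K * i)). lra.
    - apply exp_le_compat. apply Rmult_le_compat_l; nra. }
  destruct (Cexp_differences t L m) as [D1 D2].
  rewrite D1, D2.
  assert (HEW : (0 <= E * W)%R) by nra.
  replace (E * B * W)%R with (E * W * B)%R by ring.
  split; [|split].
  - eapply Rle_trans; [exact Hu|]. unfold B. nra.
  - rewrite Rmult_assoc. apply Cmod_mult_le; [exact Hu|].
    eapply Rle_trans; [apply Cmod_Cexp_sub_1_le|]. rewrite Cmod_mult. fold T.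
    apply (Rle_trans _ (3 * (T * (K * i)) * E)).
    + pose proof (Cmod_ge_0 (Cdiff L m)).
      apply Rmult_le_compat; [nra|left; apply exp_pos|nra|].
      apply exp_le_compat. nra.
    + replace (3 * (T * (K * i)) * E)%R with (3 * (T * K) * E * i)%R by ring.
      apply Rmult_le_compat_r; [lra|]. unfold B; lra.
  - rewrite Rmult_assoc. apply Cmod_mult_le; [exact Hu|].
    assert (Hi2 : (0 <= i ^ 2)%R) by nra.
    apply (Rle_trans _ (4 * (T ^ 2 * (3 * K) ^ 2) * E3 * i ^ 2
      + 2 * (4 * (T ^ 2 * (3 * K) ^ 2) * E3 * i ^ 2) + T * (K * i ^ 2))).
    + apply Cmod_plus_le; [apply Cmod_plus_le|].
      * apply (Hrem _ (3 * K)%R); [|lra].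
        replace (3 * K * i)%R with (2 * (K * i) + K * i)%R by ring.
        apply Cmod_plus_le.
        -- apply Cmod_mult_le; [rewrite Cmod_R, Rabs_pos_eq; lra|auto].
        -- eapply Rle_trans; [exact H2|]. apply Rmult_le_compat_l; nra.
      * rewrite Cmod_opp.
        apply Cmod_mult_le; [rewrite Cmod_R, Rabs_pos_eq; lra|].
        apply (Hrem _ K); [auto|lra].
      * apply Cmod_mult_le; [apply Rle_refl|auto].
    + replace (4 * (T ^ 2 * (3 * K) ^ 2) * E3 * i ^ 2
        + 2 * (4 * (T ^ 2 * (3 * K) ^ 2) * E3 * i ^ 2) + T * (K * i ^ 2))%R
        with ((12 * (T ^ 2 * (3 * K) ^ 2) * E3 + T * K) * i ^ 2)%R by ring.
      apply Rmult_le_compat_r; [lra|]. unfold B; lra.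
Qed.

Lemma Cmod_log_growth_le (c K : R) (L : nat -> C) (m : nat) :
  (0 <= c)%R -> log_growth c K L ->
  (Cmod (L m) <= c * ln (INR (S m)) + K)%R.
Proof.
  intros Hc HL. destruct (HL m) as (H & _ & _).
  replace (L m) with (RtoC (c * ln (INR (S m)))
    + (L m - RtoC (c * ln (INR (S m))))) by ring.
  apply Cmod_plus_le; [|exact H].
  rewrite Cmod_R, Rabs_pos_eq; [lra|].
  apply Rmult_le_pos; [auto|apply ln_INR_S_nonneg].
Qed.

(** Logarithms grow slower than any power; [1/16] is small enough for two factors
    [L] and one factor [e^(|t||L|)] to be of order at most [1/4]. *)
Lemma symb_log_growth (c K : R) (L : nat -> C) :
  (0 <= c)%R -> log_growth c K L -> symb (16 * c + K) (/ 16) L.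
Proof.
  intros Hc HL m. pose proof (log_growth_nonneg _ _ _ HL) as HK.
  pose proof (Cmod_log_growth_le _ _ _ m Hc HL) as H0.
  destruct (HL m) as (_ & H1 & H2).
  pose proof (inv_INR_S m) as [Hi0 Hi1].
  unfold Rdiv in *. rewrite <- !pow_inv in *.
  set (i := (/ INR (S m))%R) in *.
  unfold Rpower. pose proof (ln_INR_S_nonneg m) as Hl.
  pose proof (exp_ineq1_le (/ 16 * ln (INR (S m)))) as He.
  set (W := exp (/ 16 * ln (INR (S m)))) in *.
  assert (HKW : (K <= (16 * c + K) * W)%R) by nra.
  repeat split.
  - nra.
  - eapply Rle_trans; [exact H1|]. apply Rmult_le_compat_r; lra.
  - eapply Rle_trans; [exact H2|]. apply Rmult_le_compat_r; nra.
Qed.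

(** The point is that [K'] does not depend on [t]: after summation, this becomes
    the quadratic Taylor remainder of the continued function. For
    [|t| <= 1 / (8 c)] the factor [e^(|t||L|)] is of order at most [1/8]. *)
Lemma symb_Cexp_rem (c K : R) (L : nat -> C) :
  (0 < c)%R -> log_growth c K L ->
  exists K', forall t : C, (Cmod t <= / (8 * c))%R ->
    symb (K' * Cmod t ^ 2) (/ 4) (fun m => Cexp_rem (t * L m)).
Proof.
  intros Hc HL. pose proof (log_growth_nonneg _ _ _ HL) as HK.
  set (d := (/ (8 * c))%R).
  assert (Hd : (0 < d)%R) by (apply Rinv_0_lt_compat; lra).
  set (K1 := (16 * c + K)%R).
  assert (HK1 : (0 < K1)%R) by (unfold K1; lra).
  set (E := exp (d * K)). set (E3 := exp (d * (3 * K))).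
  assert (HE : (1 <= E)%R)
    by (unfold E; rewrite <- exp_0; apply exp_le_compat; nra).
  assert (HE3 : (0 < E3)%R) by apply exp_pos.
  set (G := (4 * (3 * K) ^ 2 * E3)%R).
  assert (HG : (0 <= G)%R) by (unfold G; pose proof (pow2_ge_0 (3 * K)); nra).
  exists (4 * K1 ^ 2 * E + 3 * (E * G) + 3 * K * K1 * E)%R.
  intros t Ht m. fold d in Ht.
  pose proof (Cmod_ge_0 t) as HT. set (T := Cmod t) in *.
  destruct (symb_log_growth c K L ltac:(lra) HL m) as (HB & _ & _).
  fold K1 in HB.
  pose proof (Cmod_log_growth_le c K L m ltac:(lra) HL) as HB'.
  destruct (HL m) as (_ & H1 & H2).
  pose proof (inv_INR_S m) as [Hi0 Hi1].
  pose proof (ln_INR_S_nonneg m) as Hl.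
  unfold Rdiv in *. rewrite <- !pow_inv in *.
  set (i := (/ INR (S m))%R) in *.
  replace (Rpower (INR (S m)) (/ 4)) with
    (Rpower (INR (S m)) (/ 16) * Rpower (INR (S m)) (/ 16)
     * Rpower (INR (S m)) (/ 8))%R
    by (rewrite <- !Rpower_plus; f_equal; lra).
  assert (HGr : (exp (T * Cmod (L m)) <= E * Rpower (INR (S m)) (/ 8))%R).
  { unfold E, Rpower. rewrite <- exp_plus. apply exp_le_compat.
    replace (/ 8)%R with (d * c)%R by (unfold d; field; lra).
    pose proof (Cmod_ge_0 (L m)). nra. }
  assert (Hw1 : (1 <= Rpower (INR (S m)) (/ 16))%R).
  { unfold Rpower. rewrite <- exp_0. apply exp_le_compat. lra. }
  assert (Hw2 : (1 <= Rpower (INR (S m)) (/ 8))%R).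
  { unfold Rpower. rewrite <- exp_0. apply exp_le_compat. lra. }
  set (w := Rpower (INR (S m)) (/ 16)) in *.
  set (v := Rpower (INR (S m)) (/ 8)) in *.
  set (l := Cmod (L m)) in *.
  assert (Hl0 : (0 <= l)%R) by apply Cmod_ge_0.
  assert (Hww : (1 <= w * w)%R) by nra.
  assert (Hwv : (0 <= w * v <= w * w * v)%R).
  { assert (Hp : (0 <= w * v)%R) by nra. split; [exact Hp|].
    pose proof (Rmult_le_pos (w - 1) (w * v) ltac:(lra) Hp). lra. }
  assert (HKE : (0 <= K1 * E)%R) by nra.
  (* for k = 0, 1, 2 the number |L|^k e^(|t||L|) is of order at most 1/4,
     here written as 1/16 + 1/16 + 1/8 *)
  assert (B0 : (Cmod (Cexp (t * L m)) <= E * (w * w * v))%R).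
  { rewrite Cmod_Cexp. eapply Rle_trans; [apply exp_Re_le|].
    rewrite Cmod_mult. fold T l. eapply Rle_trans; [exact HGr|].
    apply Rmult_le_compat_l; nra. }
  assert (B1 : (Cmod (Cexp (t * L m) - 1) <= 3 * T * (K1 * E * (w * w * v)))%R).
  { eapply Rle_trans; [apply Cmod_Cexp_sub_1_le|]. rewrite Cmod_mult. fold T l.
    apply (Rle_trans _ (3 * T * ((K1 * w) * (E * v)))).
    - replace (3 * (T * l) * exp (T * l))%R
        with (3 * T * (l * exp (T * l)))%R by ring.
      apply Rmult_le_compat_l; [lra|].
      apply Rmult_le_compat; auto. left; apply exp_pos.
    - apply Rmult_le_compat_l; [lra|].
      replace (K1 * w * (E * v))%R with (K1 * E * (w * v))%R by ring.
      apply Rmult_le_compat_l; lra. }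
  assert (B2 : (Cmod (Cexp_rem (t * L m))
    <= 4 * K1 ^ 2 * E * T ^ 2 * (w * w * v))%R).
  { eapply Rle_trans; [apply Cmod_Cexp_rem_le|]. rewrite Cmod_mult. fold T l.
    replace (4 * K1 ^ 2 * E * T ^ 2 * (w * w * v))%R
      with (4 * (T * (K1 * w)) ^ 2 * (E * v))%R by ring.
    apply Rmult_le_compat; auto.
    - pose proof (pow2_ge_0 (T * l)); lra.
    - left; apply exp_pos.
    - apply Rmult_le_compat_l; [lra|]. apply pow_incr. nra. }
  assert (Hrem : forall d' e, (Cmod d' <= e * i)%R -> (0 <= e <= 3 * K)%R ->
    (Cmod (Cexp_rem (t * d')) <= G * T ^ 2 * i ^ 2)%R).
  { intros d' e Hd' He.
    eapply Rle_trans; [apply (Cmod_Cexp_rem_scal_le t d' d (3 * K * i)); [exact Ht|nra]|].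
    fold T. unfold G.
    replace (4 * (3 * K) ^ 2 * E3 * T ^ 2 * i ^ 2)%R
      with (4 * (T ^ 2 * (3 * K * i) ^ 2) * E3)%R by ring.
    apply Rmult_le_compat_l.
    - rewrite <- Rpow_mult_distr. pose proof (pow2_ge_0 (T * (3 * K * i))). lra.
    - apply exp_le_compat. apply Rmult_le_compat_l; nra. }
  set (X := (w * w * v)%R) in *.
  assert (HX : (0 <= X)%R) by (unfold X; nra).
  assert (HT2 : (0 <= T ^ 2)%R) by apply pow2_ge_0.
  assert (HK1E : (0 <= 4 * K1 ^ 2 * E)%R) by (pose proof (pow2_ge_0 K1); nra).
  assert (HEG : (0 <= E * G)%R) by nra.
  assert (HKK : (0 <= 3 * K * K1 * E)%R)
    by (repeat apply Rmult_le_pos; lra).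
  assert (HTX : (0 <= T ^ 2 * X)%R) by nra.
  assert (Hi2 : (0 <= i ^ 2 <= i)%R) by nra.
  destruct (Cexp_rem_differences t L m) as [D1 D2]. rewrite D1, D2.
  rewrite !(Rmult_assoc _ (T ^ 2) X).
  split; [|split].
  - eapply Rle_trans; [exact B2|]. rewrite (Rmult_assoc _ (T ^ 2) X).
    apply Rmult_le_compat_r; lra.
  - apply (Rle_trans _ (E * X * (G * T ^ 2 * i ^ 2)
      + T * (K * i) * (3 * T * (K1 * E * X)))).
    + apply Cmod_plus_le; repeat apply Cmod_mult_le; auto; try apply Rle_refl.
      apply (Hrem _ K); [auto|lra].
    + apply (Rle_trans _ ((E * G) * (T ^ 2 * X) * i + (3 * K * K1 * E) * (T ^ 2 * X) * i)).
      * apply Rplus_le_compat.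
        -- replace (E * X * (G * T ^ 2 * i ^ 2))%R
             with ((E * G) * (T ^ 2 * X) * i ^ 2)%R by ring.
           apply Rmult_le_compat_l; nra.
        -- right; ring.
      * rewrite <- Rmult_plus_distr_r, <- Rmult_plus_distr_r.
        apply Rmult_le_compat_r; [lra|]. apply Rmult_le_compat_r; lra.
  - apply (Rle_trans _ (E * X * (G * T ^ 2 * i ^ 2 + 2 * (G * T ^ 2 * i ^ 2))
      + T * (K * i ^ 2) * (3 * T * (K1 * E * X)))).
    + apply Cmod_plus_le; repeat apply Cmod_mult_le; auto; try apply Rle_refl.
      apply Cmod_plus_le.
      * apply (Hrem _ (3 * K)%R); [|lra].
        replace (3 * K * i)%R with (2 * (K * i) + K * i)%R by ring.
        apply Cmod_plus_le.
        -- apply Cmod_mult_le; [rewrite Cmod_R, Rabs_pos_eq; lra|auto].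
        -- eapply Rle_trans; [exact H2|]. apply Rmult_le_compat_l; lra.
      * rewrite Cmod_opp.
        apply Cmod_mult_le; [rewrite Cmod_R, Rabs_pos_eq; lra|].
        apply (Hrem _ K); [auto|lra].
    + match goal with |- (?l <= _)%R => replace l
        with ((3 * (E * G) + 3 * K * K1 * E) * (T ^ 2 * X) * i ^ 2)%R by ring end.
      apply Rmult_le_compat_r; [lra|]. apply Rmult_le_compat_r; lra.
Qed.

Lemma Cplus_sub_cancel (z w : C) : z + (w - z) = w.
Proof. ring. Qed.

Lemma is_derive_of_quadratic (f : C -> C) (z l : C) (K d : R) :
  (0 < d)%R ->
  (forall h, (Cmod h <= d)%R ->
    (Cmod (f (z + h)%C - f z - h * l) <= K * Cmod h ^ 2)%R) ->
  @is_derive C_AbsRing C_NormedModule f z l.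
Proof.
  intros Hd H. split; [apply (is_linear_scal_l (V := C_NormedModule))|].
  intros z' Hz'.
  assert (z = z').
  { apply (is_filter_lim_locally_unique (V := AbsRing_NormedModule C_AbsRing)).
    exact Hz'. }
  subst z'. intros eps.
  assert (HK : (0 < Rabs K + 1)%R) by (pose proof (Rabs_pos K); lra).
  set (r := Rmin d (eps / (Rabs K + 1))).
  assert (Hr : (0 < r)%R).
  { apply Rmin_pos; [auto|]. apply Rdiv_lt_0_compat; [apply eps|auto]. }
  exists (mkposreal r Hr). intros w Hw.
  change (Cmod (w - z) < r)%R in Hw.
  change (Cmod (f w - f z - (w - z) * l) <= eps * Cmod (w - z))%R.
  assert (Hwd : (Cmod (w - z) <= d)%R)
    by (pose proof (Rmin_l d (eps / (Rabs K + 1))); unfold r in Hw; lra).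
  specialize (H (w - z) Hwd).
  rewrite (Cplus_sub_cancel z w) in H.
  eapply Rle_trans; [exact H|].
  pose proof (Cmod_ge_0 (w - z)).
  replace (K * Cmod (w - z) ^ 2)%R with (K * Cmod (w - z) * Cmod (w - z))%R by ring.
  apply Rmult_le_compat_r; auto.
  assert (Hwe : (Cmod (w - z) <= eps / (Rabs K + 1))%R)
    by (pose proof (Rmin_r d (eps / (Rabs K + 1))); unfold r in Hw; lra).
  apply (Rmult_le_compat_l (Rabs K + 1)) in Hwe; [|lra].
  replace ((Rabs K + 1) * (eps / (Rabs K + 1)))%R with (pos eps) in Hwe
    by (field; lra).
  pose proof (Rle_abs K). nra.
Qed.

Lemma altsum_iota (u : nat -> C) (l : C) :
  is_altsum u l -> iota (T := C_CompleteNormedModule) (is_altsum u) = l.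
Proof.
  intros H. apply (iota_unique (V := C_CompleteNormedModule)); [|exact H].
  intros y Hy. exact (is_altsum_unique _ _ _ Hy H).
Qed.

(** The accelerated sums of [e^(-s L)] continue the series to
    [Re s > - 1 / (4 c)]. By linearity of the summation, the first-order Taylor
    remainder of the sum at [s] is the sum of [e^(-s L)] times the remainder of
    [e^(-h L)], which [symb_Cexp_rem] bounds by a multiple of [|h|^2]; so the
    derivative is minus the sum of [L e^(-s L)], which at [s = 0] is minus the
    sum of [L]. *)
Theorem alt_zeta_value_of_log_growth (c K : R) (L : nat -> C) (l : C) :
  (0 < c)%R -> log_growth c K L -> is_altsum L l ->
  is_alt_zeta_value (fun m s => Cexp (- s * L m)) (Cexp l).
Proof.
  intros Hc HL Hl.
  set (F := fun s : C => iota (T := C_CompleteNormedModule)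
    (is_altsum (fun m => Cexp (- s * L m))) : C).
  assert (Hd : (0 < / (8 * c))%R) by (apply Rinv_0_lt_compat; lra).
  assert (Hcd : (c * / (8 * c) = / 8)%R) by (field; lra).
  (* the margin from 2/(8c), the bound in HD, to 3/(8c) leaves room for the
     increments h with |h| <= 1/(8c) *)
  assert (HF : forall s, (- (3 * / (8 * c)) <= Re s)%R ->
    is_altsum (fun m => Cexp (- s * L m)) (F s)).
  { intros s Hs. destruct (symb_Cexp c K L (- s) HL) as [K' HK'].
    apply symb_weaken with (b := (/ 2)%R) in HK'.
    2:{ rewrite re_opp. nra. }
    destruct (altsum_symb _ _ HK') as [v [Hv _]].
    unfold F. rewrite (altsum_iota _ _ Hv). exact Hv. }
  assert (HD : forall s, (- (2 * / (8 * c)) <= Re s)%R -> exists v,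
    is_altsum (fun m => L m * Cexp (- s * L m)) v /\
    @is_derive C_AbsRing C_NormedModule F s (- v)).
  { intros s Hs. destruct (symb_Cexp c K L (- s) HL) as [K' HK'].
    apply symb_weaken with (b := (/ 4)%R) in HK'.
    2:{ rewrite re_opp. nra. }
    pose proof (symb_log_growth c K L ltac:(lra) HL) as HLs.
    pose proof (symb_mult _ _ _ _ _ _ HLs HK') as HLE.
    apply symb_weaken with (b := (/ 2)%R) in HLE; [|lra].
    destruct (altsum_symb _ _ HLE) as [v [Hv _]].
    exists v. split; [exact Hv|].
    destruct (symb_Cexp_rem c K L Hc HL) as [K2 HK2].
    apply (is_derive_of_quadratic F s (- v) (2 * (9 * (K' * K2))) (/ (8 * c)) Hd).
    intros h Hh.
    assert (Hh' : (Cmod (- h) <= / (8 * c))%R) by now rewrite Cmod_opp.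
    pose proof (symb_mult _ _ _ _ _ _ HK' (HK2 (- h) Hh')) as HR.
    apply symb_weaken with (b := (/ 2)%R) in HR; [|lra].
    destruct (altsum_symb _ _ HR) as [r [Hr Hrb]].
    rewrite Cmod_opp in Hrb.
    assert (Hsh : (- (3 * / (8 * c)) <= Re (s + h))%R).
    { rewrite re_plus. pose proof (re_le_Cmod h) as H1.
      apply Rabs_le_between in H1. lra. }
    replace (F (s + h) - F s - h * - v) with r.
    { eapply Rle_trans; [exact Hrb|]. right; ring. }
    apply (is_altsum_unique _ _ _ Hr).
    apply (is_altsum_ext (fun m => Cexp (- (s + h) * L m)
      + (- (1)) * (Cexp (- s * L m) + (- h) * (L m * Cexp (- s * L m))))).
    - intros m. replace (- (s + h) * L m) with (- s * L m + - h * L m) by ring.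
      rewrite Cexp_plus. unfold Cexp_rem. ring.
    - replace (F (s + h) - F s - h * - v)
        with (F (s + h) + (- (1)) * (F s + (- h) * v)) by ring.
      repeat apply is_altsum_lin; auto. apply HF. lra. }
  exists F, (2 * / (8 * c))%R, (- l).
  split; [lra|]. split; [|split; [|split]].
  - intros s Hs. apply altsum_is_series.
    + destruct (symb_Cexp c K L (- s) HL) as [K' HK'].
      refine (symb_lim_0 _ _ _ _ HK'). rewrite re_opp. nra.
    + apply HF. lra.
  - intros s Hs. destruct (HD s) as [v [_ Hv]].
    + destruct Hs as [Hs|Hs]; [lra|].
      pose proof (re_le_Cmod s) as H1. apply Rabs_le_between in H1. lra.
    + now exists (- v).
  - destruct (HD 0) as [v [Hv Hv']]; [rewrite re_RtoC; lra|].
    replace l with v; [exact Hv'|].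
    apply (is_altsum_unique _ _ _ Hv).
    apply (is_altsum_ext L); [|exact Hl].
    intros m. replace (- 0 * L m) with (RtoC 0) by ring. rewrite Cexp_0. ring.
  - f_equal. ring.
Qed.

(** * The principal logarithm *)

Lemma Re_div_Cmod_bounds (z : C) :
  z <> 0 -> (-1 <= Re z / Cmod z <= 1)%R.
Proof.
  intros Hz. apply Cmod_gt_0 in Hz.
  apply Rabs_le_between. unfold Rdiv. rewrite Rabs_mult.
  rewrite (Rabs_pos_eq (/ Cmod z)) by (left; now apply Rinv_0_lt_compat).
  apply Rmult_le_reg_r with (Cmod z); [auto|].
  rewrite Rmult_assoc, Rinv_l, Rmult_1_r, Rmult_1_l by lra.
  apply re_le_Cmod.
Qed.

Lemma Cexp_Clog (z : C) : z <> 0 -> Cexp (Clog z) = z.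
Proof.
  intros Hz. pose proof (Re_div_Cmod_bounds z Hz) as Hb.
  apply Cmod_gt_0 in Hz.
  assert (Hs : sqrt (1 - (Re z / Cmod z)²) = (Rabs (Im z) / Cmod z)%R).
  { rewrite <- (sqrt_Rsqr (Rabs (Im z) / Cmod z)).
    - f_equal. pose proof (Cmod2_alt z) as H.
      unfold Rdiv. rewrite !Rsqr_mult, <- Rsqr_abs. unfold Rsqr.
      field_simplify_eq; [nra|lra].
    - apply Rmult_le_pos; [apply Rabs_pos|left; now apply Rinv_0_lt_compat]. }
  unfold Cexp, Clog. simpl. rewrite exp_ln by auto.
  assert (Hcs : cos (Carg z) = (Re z / Cmod z)%R
    /\ sin (Carg z) = (Im z / Cmod z)%R).
  { unfold Carg. destruct (Rle_dec 0 (Im z)) as [Hi|Hi].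
    - rewrite cos_acos, sin_acos, Hs, Rabs_pos_eq by auto. auto.
    - rewrite cos_neg, sin_neg, cos_acos, sin_acos, Hs, Rabs_left by lra.
      split; [auto|]. field. lra. }
  destruct Hcs as [-> ->].
  destruct z as [a b]; simpl in *. apply injective_projections; simpl; field; lra.
Qed.

(** Identities between principal logarithms hold once the exponentials agree and
    the imaginary part stays inside the strip; all the identities below are
    obtained in this way. *)
Lemma Clog_Cexp (w : C) : (Rabs (Im w) < PI)%R -> Clog (Cexp w) = w.
Proof.
  intros Hw. apply Rabs_def2 in Hw.
  unfold Clog. rewrite Cmod_Cexp, ln_exp.
  assert (Ha : Carg (Cexp w) = Im w); [|rewrite Ha; now destruct w].
  unfold Carg. rewrite Cmod_Cexp. destruct w as [a b]. simpl in *.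
  pose proof (exp_pos a).
  replace (exp a * cos b / exp a)%R with (cos b) by (field; lra).
  destruct (Rle_dec 0 (exp a * sin b)) as [Hs|Hs].
  - apply acos_cos. split; [|lra]. apply Rnot_lt_le. intros Hb.
    pose proof (sin_gt_0 (- b)) as Hn. rewrite sin_neg in Hn. nra.
  - rewrite <- cos_neg, acos_cos; [ring|].
    split; [|lra]. assert (~ (0 <= b))%R; [|lra].
    intros Hb. pose proof (sin_ge_0 b). apply Hs.
    apply Rmult_le_pos; lra.
Qed.

Lemma Im_Clog_right (z : C) :
  (0 < Re z)%R -> Im (Clog z) = atan (Im z / Re z).
Proof.
  intros Hz.
  set (w := (ln (Cmod z), atan (Im z / Re z)) : C).
  assert (Hm : (0 < Cmod z)%R).
  { apply Cmod_gt_0. intros E. rewrite E in Hz. simpl in Hz. lra. }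
  assert (Hw : Cexp w = z).
  { unfold Cexp, w. simpl. rewrite exp_ln, cos_atan, sin_atan by auto.
    assert (Hs : sqrt (1 + (Im z / Re z)²) = (Cmod z / Re z)%R).
    { rewrite <- (sqrt_Rsqr (Cmod z / Re z)).
      - f_equal. pose proof (Cmod2_alt z) as H.
        unfold Rdiv. rewrite !Rsqr_mult. unfold Rsqr.
        field_simplify_eq; [nra|lra].
      - left. now apply Rdiv_lt_0_compat. }
    rewrite Hs. destruct z as [a b]; simpl in *.
    apply injective_projections; simpl; field; lra. }
  rewrite <- Hw at 1. rewrite Clog_Cexp; [reflexivity|].
  pose proof (atan_bound (Im z / Re z)). pose proof PI_RGT_0.
  apply Rabs_def1; simpl; lra.
Qed.

Lemma Rabs_atan_le (x : R) : (Rabs (atan x) <= Rabs x)%R.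
Proof.
  destruct (MVT_abs atan (fun t => / (1 + t ^ 2))%R 0 x) as [c [H _]].
  { intros c _. exact (derivable_pt_lim_atan c). }
  rewrite atan_0, !Rminus_0_r in H. rewrite H.
  rewrite <- (Rmult_1_l (Rabs x)) at 2.
  apply Rmult_le_compat_r; [apply Rabs_pos|].
  pose proof (pow2_ge_0 c).
  rewrite Rabs_pos_eq by (left; apply Rinv_0_lt_compat; lra).
  rewrite <- Rinv_1 at 2. apply Rinv_le_contravar; lra.
Qed.

Lemma Rabs_ln_1_plus_le (x : R) :
  (Rabs x <= / 2 -> Rabs (ln (1 + x)) <= 2 * Rabs x)%R.
Proof.
  intros Hx. pose proof Hx as Hb. apply Rabs_le_between in Hb.
  assert (H1 : (ln (1 + x) <= x)%R).
  { pose proof (exp_ineq1_le (ln (1 + x))) as H. rewrite exp_ln in H by lra. lra. }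
  assert (H2 : (- (2 * Rabs x) <= ln (1 + x))%R).
  { pose proof (exp_ineq1_le (- ln (1 + x))) as H.
    rewrite exp_Ropp, exp_ln in H by lra.
    assert (/ (1 + x) - 1 <= 2 * Rabs x)%R; [|lra].
    replace (/ (1 + x) - 1)%R with (- x * / (1 + x))%R by (field; lra).
    assert (/ (1 + x) <= 2)%R.
    { replace 2%R with (/ (/ 2))%R by field. apply Rinv_le_contravar; lra. }
    assert (0 < / (1 + x))%R by (apply Rinv_0_lt_compat; lra).
    unfold Rabs; destruct (Rcase_abs x); nra. }
  apply Rabs_le. pose proof (Rabs_pos x). pose proof (Rle_abs x). lra.
Qed.

Lemma Cmod_Clog_1_plus_le (u : C) :
  (Cmod u <= / 2)%R -> (Cmod (Clog (1 + u)) <= 4 * Cmod u)%R.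
Proof.
  intros Hu. pose proof (re_le_Cmod u) as Hre. pose proof (Im_le_Cmod u) as Him.
  assert (Hr : (/ 2 <= Re (1 + u))%R).
  { rewrite re_plus, re_RtoC. apply Rabs_le_between in Hre. lra. }
  assert (Hm : (Rabs (Cmod (1 + u) - 1) <= Cmod u)%R).
  { apply Rabs_le. rewrite <- Cmod_1 at 2 4.
    pose proof (Cmod_triangle 1 u).
    pose proof (Cmod_triangle (1 + u) (- u)) as H'.
    rewrite Cmod_opp in H'. replace (1 + u + - u) with (RtoC 1) in H' by ring.
    lra. }
  eapply Rle_trans; [apply Cmod_le_Re_Im|].
  rewrite Im_Clog_right by lra. unfold Clog; simpl Re.
  assert (H1 : (Rabs (ln (Cmod (1 + u))) <= 2 * Cmod u)%R).
  { replace (Cmod (1 + u)) with (1 + (Cmod (1 + u) - 1))%R by ring.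
    eapply Rle_trans; [apply Rabs_ln_1_plus_le; lra|]. lra. }
  assert (H2 : (Rabs (atan (Im (1 + u) / Re (1 + u))) <= 2 * Cmod u)%R).
  { eapply Rle_trans; [apply Rabs_atan_le|].
    unfold Rdiv. rewrite Rabs_mult, im_plus, im_RtoC, Rplus_0_l.
    rewrite (Rabs_pos_eq (/ _)) by (left; apply Rinv_0_lt_compat; lra).
    assert (/ Re (1 + u) <= 2)%R.
    { replace 2%R with (/ (/ 2))%R by field. apply Rinv_le_contravar; lra. }
    assert (0 < / Re (1 + u))%R by (apply Rinv_0_lt_compat; lra).
    pose proof (Rabs_pos (Im u)). nra. }
  change (Rabs (ln (Cmod (1 + u))) + Rabs (atan (Im (1 + u) / Re (1 + u)))
    <= 4 * Cmod u)%R. lra.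
Qed.

(** * Logarithms of shifted integers *)

Lemma Im_sub (a b : C) : Im (a - b) = (Im a - Im b)%R.
Proof. unfold Cminus. rewrite im_plus, im_opp. ring. Qed.

(** The class of sequences of logarithms to which the regularization applies:
    stable under sums and under changes of finitely many terms, which covers all
    choices of branches. *)
Definition log_like (c : R) (L : nat -> C) : Prop :=
  Clim (fun m => L m - RtoC (c * ln (INR (S m)))) 0 /\
  exists K, log_growth c K L.

Lemma bound_of_eventually (f g : nat -> R) (K : R) (N : nat) :
  (forall m, (0 < g m)%R) ->
  (forall m, (N <= m)%nat -> (f m <= K * g m)%R) ->
  exists K', (K <= K')%R /\ forall m, (f m <= K' * g m)%R.
Proof.
  intros Hg. revert K. induction N as [|N IH]; intros K H.
  - exists K. split; [lra|]. intros m; apply H; lia.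
  - destruct (IH (Rmax K (f N / g N))) as [K' [HK' H']].
    + intros m Hm. destruct (Nat.eq_dec m N) as [->|Hne].
      * apply (Rle_trans _ (f N / g N * g N)).
        -- right; field. specialize (Hg N); lra.
        -- apply Rmult_le_compat_r; [left; apply Hg|apply Rmax_r].
      * apply (Rle_trans _ (K * g m)); [apply H; lia|].
        apply Rmult_le_compat_r; [left; apply Hg|apply Rmax_l].
    + exists K'. split; [|exact H'].
      eapply Rle_trans; [apply Rmax_l|exact HK'].
Qed.

Lemma log_like_intro (c K : R) (N : nat) (L : nat -> C) :
  Clim (fun m => L m - RtoC (c * ln (INR (S m)))) 0 ->
  (forall m, (N <= m)%nat -> (Cmod (Cdiff L m) <= K / INR (S m) /\
     Cmod (Cdiff (Cdiff L) m) <= K / INR (S m) ^ 2)%R) ->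
  log_like c L.
Proof.
  intros Hl H. split; [exact Hl|].
  destruct (Clim_bounded _ _ Hl) as [K0 H0].
  destruct (bound_of_eventually (fun m => Cmod (Cdiff L m))
    (fun m => / INR (S m))%R K N) as [K1 [_ H1]].
  { intros m; apply inv_INR_S. }
  { intros m Hm; apply H, Hm. }
  destruct (bound_of_eventually (fun m => Cmod (Cdiff (Cdiff L) m))
    (fun m => / INR (S m) ^ 2)%R K N) as [K2 [_ H2]].
  { intros m. apply Rinv_0_lt_compat, pow_lt. pose proof (INR_S_ge_1 m). lra. }
  { intros m Hm; apply H, Hm. }
  exists (Rmax K0 (Rmax K1 K2)). intros m.
  pose proof (inv_INR_S m) as [Hi _].
  repeat split.
  - eapply Rle_trans; [apply H0|apply Rmax_l].
  - eapply Rle_trans; [apply H1|]. apply Rmult_le_compat_r; [lra|].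
    eapply Rle_trans; [apply Rmax_l|apply Rmax_r].
  - eapply Rle_trans; [apply H2|]. apply Rmult_le_compat_r.
    + left. apply Rinv_0_lt_compat, pow_lt. pose proof (INR_S_ge_1 m). lra.
    + eapply Rle_trans; [apply Rmax_r|apply Rmax_r].
Qed.

Lemma log_like_ext_loc (c : R) (L L' : nat -> C) :
  eventually (fun m => L m = L' m) -> log_like c L -> log_like c L'.
Proof.
  intros [N HN] [Hl [K HK]].
  apply (log_like_intro c K N).
  - eapply Clim_ext_loc; [|exact Hl].
    exists N. intros m Hm. now rewrite HN.
  - intros m Hm. destruct (HK m) as (_ & H1 & H2).
    unfold Cdiff in *. rewrite !HN in * by lia. auto.
Qed.

Lemma log_like_0 : log_like 0 (fun _ => 0).
Proof.
  apply (log_like_intro 0 0 O).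
  - apply (Clim_ext (fun _ => 0)); [|apply Clim_const].
    intros m. rewrite Rmult_0_l. ring.
  - intros m _. unfold Cdiff, Rdiv. rewrite !Rmult_0_l.
    replace (0 - 0 - (0 - 0)) with (RtoC 0) by ring.
    replace (0 - 0) with (RtoC 0) by ring. rewrite Cmod_0. lra.
Qed.

Lemma log_like_plus (c c' : R) (L L' : nat -> C) :
  log_like c L -> log_like c' L' -> log_like (c + c') (fun m => L m + L' m).
Proof.
  intros [Hl [K HK]] [Hl' [K' HK']].
  apply (log_like_intro _ (K + K') O).
  - apply (Clim_ext (fun m => (L m - RtoC (c * ln (INR (S m))))
      + (L' m - RtoC (c' * ln (INR (S m)))))).
    + intros m. rewrite Rmult_plus_distr_r, RtoC_plus. ring.
    + replace (RtoC 0) with (0 + 0) by ring. now apply Clim_plus.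
  - intros m _. destruct (HK m) as (_ & H1 & H2).
    destruct (HK' m) as (_ & H1' & H2').
    unfold Rdiv. rewrite !Rmult_plus_distr_r. split.
    + replace (Cdiff (fun k => L k + L' k) m) with (Cdiff L m + Cdiff L' m)
        by (unfold Cdiff; ring).
      now apply Cmod_plus_le.
    + replace (Cdiff (Cdiff (fun k => L k + L' k)) m)
        with (Cdiff (Cdiff L) m + Cdiff (Cdiff L') m) by (unfold Cdiff; ring).
      now apply Cmod_plus_le.
Qed.

Fixpoint Csum (f : nat -> C) (n : nat) : C :=
  match n with
  | O => 0
  | S k => Csum f k + f k
  end.

Lemma log_like_Csum (L : nat -> nat -> C) (n : nat) :
  (forall j, (j < n)%nat -> log_like 1 (L j)) ->
  log_like (INR n) (fun m => Csum (fun j => L j m) n).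
Proof.
  induction n as [|n IH]; intros H.
  - apply log_like_0.
  - rewrite S_INR. apply log_like_plus; [|apply H; lia].
    apply IH. intros j Hj; apply H; lia.
Qed.

Lemma log_like_altsum (c : R) (L : nat -> C) :
  (0 <= c)%R -> log_like c L -> exists l, is_altsum L l.
Proof.
  intros Hc [_ [K HK]].
  destruct (altsum_symb (16 * c + K) L) as [l [Hl _]]; [|now exists l].
  apply (symb_weaken _ (/ 16)); [lra|]. now apply symb_log_growth.
Qed.

Lemma Re_shift_pos (z : C) (m : nat) :
  (9 * Cmod z + 9 <= INR m)%R -> (8 * Cmod z + 9 <= Re (INR m + z))%R.
Proof.
  intros Hm. rewrite re_plus, re_RtoC. pose proof (re_le_Cmod z) as H.
  apply Rabs_le_between in H. lra.
Qed.

Lemma Im_Clog_shift_small (z : C) (m : nat) :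
  (9 * Cmod z + 9 <= INR m)%R -> (Rabs (Im (Clog (INR m + z))) <= / 8)%R.
Proof.
  intros Hm. pose proof (Re_shift_pos z m Hm) as Hr. pose proof (Cmod_ge_0 z) as H0.
  rewrite Im_Clog_right by lra.
  eapply Rle_trans; [apply Rabs_atan_le|].
  unfold Rdiv. rewrite Rabs_mult, im_plus, im_RtoC, Rplus_0_l.
  rewrite (Rabs_pos_eq (/ _)) by (left; apply Rinv_0_lt_compat; lra).
  apply Rmult_le_reg_r with (Re (INR m + z)); [lra|].
  rewrite Rmult_assoc, Rinv_l, Rmult_1_r by lra.
  pose proof (Im_le_Cmod z). lra.
Qed.

Lemma Cmod_shift_ge (z : C) (m : nat) :
  (9 * Cmod z + 9 <= INR m)%R -> (INR (S m) / 2 <= Cmod (INR m + z))%R.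
Proof.
  intros Hm. rewrite S_INR.
  pose proof (Cmod_triangle (INR m + z) (- z)) as H. rewrite Cmod_opp in H.
  replace (INR m + z + - z) with (RtoC (INR m)) in H by ring.
  rewrite Cmod_R, Rabs_pos_eq in H by apply pos_INR.
  pose proof (Cmod_ge_0 z). lra.
Qed.

(** For [w = m + z], differences of logarithms are logarithms of numbers close to
    [1]: [(w + 1) / w = 1 + 1 / w] and
    [w (w + 2) / (w + 1)^2 = 1 - 1 / (w + 1)^2]. For large [m] the arguments are
    too small for a multiple of [2 pi i] to appear. *)
Lemma Clog_shift_differences (z : C) (m : nat) :
  (forall k : nat, INR k + z <> 0) -> (9 * Cmod z + 9 <= INR m)%R ->
  Cdiff (fun k => Clog (INR k + z)) m = Clog (1 + / (INR m + z)) /\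
  Cdiff (Cdiff (fun k => Clog (INR k + z))) m
    = Clog (1 + - / ((INR (S m) + z) * (INR (S m) + z))).
Proof.
  intros Hz Hm.
  assert (Hm1 : (9 * Cmod z + 9 <= INR (S m))%R) by (rewrite S_INR; lra).
  assert (Hm2 : (9 * Cmod z + 9 <= INR (S (S m)))%R) by (rewrite S_INR; lra).
  pose proof (Im_Clog_shift_small z m Hm) as I0.
  pose proof (Im_Clog_shift_small z (S m) Hm1) as I1.
  pose proof (Im_Clog_shift_small z (S (S m)) Hm2) as I2.
  apply Rabs_le_between in I0, I1, I2.
  pose proof PI2_3_2.
  assert (E1 : RtoC (INR (S m)) = INR m + 1) by now rewrite S_INR, RtoC_plus.
  assert (E2 : RtoC (INR (S (S m))) = INR m + 1 + 1)
    by (rewrite S_INR, RtoC_plus, E1; ring).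
  pose proof (Hz m) as N0. pose proof (Hz (S m)) as N1.
  split.
  - rewrite <- (Clog_Cexp (Cdiff _ m)).
    + f_equal. unfold Cdiff, Cminus.
      rewrite Cexp_plus, Cexp_opp, !Cexp_Clog by apply Hz.
      rewrite E1. field. exact N0.
    + unfold Cdiff. rewrite Im_sub. apply Rabs_def1; lra.
  - rewrite <- (Clog_Cexp (Cdiff (Cdiff _) m)).
    + f_equal.
      replace (Cdiff (Cdiff (fun k => Clog (INR k + z))) m)
        with (Clog (INR (S (S m)) + z) + Clog (INR m + z)
          + - (Clog (INR (S m) + z) + Clog (INR (S m) + z)))
        by (unfold Cdiff; ring).
      rewrite Cexp_plus, Cexp_opp, !Cexp_plus, !Cexp_Clog by apply Hz.
      rewrite E2. rewrite E1 in *. field. exact N1.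
    + unfold Cdiff. rewrite !Im_sub. apply Rabs_def1; lra.
Qed.

Lemma log_like_Clog_shift (z : C) :
  (forall k : nat, INR k + z <> 0) -> log_like 1 (fun m => Clog (INR m + z)).
Proof.
  intros Hz.
  destruct (INR_unbounded (9 * Cmod z + 9)) as [N HN].
  assert (HN' : forall m, (N <= m)%nat -> (9 * Cmod z + 9 <= INR m)%R).
  { intros m Hm. apply le_INR in Hm. lra. }
  apply (log_like_intro 1 16 N).
  - apply (Clim_ext_loc (fun m => Clog (1 + (z - 1) * / INR (S m)))).
    + exists N. intros m Hm. specialize (HN' m Hm).
      pose proof (INR_S_ge_1 m) as H1.
      assert (H1' : RtoC (INR (S m)) <> 0)
        by (intros E; apply RtoC_inj in E; lra).
      rewrite Rmult_1_l, <- (Clog_Cexp (Clog (INR m + z) - _)).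
      * f_equal. unfold Cminus. rewrite Cexp_plus, Cexp_opp, Cexp_Clog by apply Hz.
        rewrite Cexp_RtoC, exp_ln by lra.
        rewrite S_INR, RtoC_plus in *. field. exact H1'.
      * rewrite Im_sub, im_RtoC, Rminus_0_r.
        pose proof (Im_Clog_shift_small z m HN'). pose proof PI2_3_2. lra.
    + assert (Hu : Clim (fun m => 4 * (Cmod (z - 1) * / INR (S m)))%R 0).
      { replace (RtoC 0) with (RtoC (4 * (Cmod (z - 1) * 0))%R)
          by (f_equal; ring).
        apply Clim_RtoC, is_lim_seq_mult'; [apply is_lim_seq_const|].
        apply is_lim_seq_mult'; [apply is_lim_seq_const|].
        apply is_lim_seq_inv_INR_S. }
      destruct (INR_unbounded (2 * Cmod (z - 1))) as [M HM].
      unfold Clim in *.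
      apply is_lim_seq_le_le_loc with (u := fun _ => 0%R)
        (w := fun m => Cmod (RtoC (4 * (Cmod (z - 1) * / INR (S m))) - 0));
        [|apply is_lim_seq_const|exact Hu].
      exists M. intros m Hm. split; [apply Cmod_ge_0|].
      apply le_INR in Hm. pose proof (inv_INR_S m) as Hi.
      pose proof (INR_S_ge_1 m) as H1.
      assert (Hc : (Cmod ((z - 1) * / INR (S m)) = Cmod (z - 1) * / INR (S m))%R).
      { rewrite Cmod_mult, <- RtoC_inv, Cmod_R, Rabs_pos_eq by lra. reflexivity. }
      replace (Clog (1 + (z - 1) * / INR (S m)) - 0)
        with (Clog (1 + (z - 1) * / INR (S m))) by ring.
      rewrite <- RtoC_minus, Rminus_0_r, Cmod_R, <- Hc.
      eapply Rle_trans; [|apply Rle_abs].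
      apply Cmod_Clog_1_plus_le. rewrite Hc.
      apply Rmult_le_reg_r with (INR (S m)); [lra|].
      rewrite Rmult_assoc, Rinv_l, Rmult_1_r by lra.
      rewrite S_INR in *. lra.
  - intros m Hm. specialize (HN' m Hm).
    destruct (Clog_shift_differences z m Hz HN') as [-> ->].
    pose proof (Cmod_shift_ge z m HN') as G0.
    assert (G1 : (INR (S m) / 2 <= Cmod (INR (S m) + z))%R).
    { eapply Rle_trans; [|apply Cmod_shift_ge; rewrite S_INR; lra].
      rewrite (S_INR (S m)). lra. }
    pose proof (INR_S_ge_1 m) as H1.
    pose proof (Cmod_ge_0 z) as Hz0.
    assert (Hx : (10 <= INR (S m))%R) by (rewrite S_INR; lra).
    set (x := INR (S m)) in *.
    assert (B1 : (Cmod (/ (INR m + z)) <= 2 / x)%R).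
    { rewrite Cmod_inv by apply Hz.
      replace (2 / x)%R with (/ (x / 2))%R by (field; lra).
      apply Rinv_le_contravar; lra. }
    assert (B2 : (Cmod (- / ((x + z) * (x + z))) <= 4 / x ^ 2)%R).
    { rewrite Cmod_opp, Cmod_inv, Cmod_mult by (apply Cmult_neq_0; apply Hz).
      replace (4 / x ^ 2)%R with (/ (x / 2 * (x / 2)))%R by (field; lra).
      apply Rinv_le_contravar; [nra|]. apply Rmult_le_compat; lra. }
    assert (Hix : (/ x <= / 10)%R) by (apply Rinv_le_contravar; lra).
    assert (Hi0 : (0 < / x)%R) by (apply Rinv_0_lt_compat; lra).
    unfold Rdiv in *. rewrite <- !pow_inv in *.
    split.
    + eapply Rle_trans; [apply Cmod_Clog_1_plus_le; lra|]. lra.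
    + eapply Rle_trans; [apply Cmod_Clog_1_plus_le; nra|]. lra.
Qed.

Lemma log_like_Im_lim (c : R) (L : nat -> C) :
  log_like c L -> is_lim_seq (fun m => Im (L m)) 0%R.
Proof.
  intros [Hl _]. apply is_lim_seq_abs_0.
  apply (is_lim_seq_le_le (fun _ => 0%R) _
    (fun m => Cmod (L m - RtoC (c * ln (INR (S m))) - 0)));
    [|apply is_lim_seq_const|exact Hl].
  intros m. split; [apply Rabs_pos|].
  replace (Im (L m)) with (Im (L m - RtoC (c * ln (INR (S m))) - 0)).
  - apply Im_le_Cmod.
  - rewrite !Im_sub, !im_RtoC. ring.
Qed.

(** Passing to the principal logarithm of [e^(L_m)] changes only the finitely
    many [L_m] whose imaginary part leaves the principal strip, because [Im L]
    tends to [0]. *)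
Lemma log_like_Clog_Cexp (c : R) (L : nat -> C) :
  log_like c L -> log_like c (fun m => Clog (Cexp (L m))).
Proof.
  intros HL. apply (log_like_ext_loc c L); [|exact HL].
  pose proof (log_like_Im_lim c L HL) as H.
  apply is_lim_seq_spec in H.
  destruct (H (mkposreal PI PI_RGT_0)) as [N HN]. exists N. intros m Hm.
  symmetry. apply Clog_Cexp. specialize (HN m Hm). simpl in HN.
  now rewrite Rminus_0_r in HN.
Qed.

(** * Regularized products as limits of partial products *)

Lemma Cprod_ext (f g : nat -> C) (n : nat) :
  (forall j, (j < n)%nat -> f j = g j) -> Cprod f n = Cprod g n.
Proof.
  intros H. induction n as [|n IH]; simpl; [auto|].
  rewrite IH, H by (try intros; try apply H; lia). reflexivity.
Qed.

Lemma Cprod_mult (f g : nat -> C) (n : nat) :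
  Cprod (fun j => f j * g j) n = Cprod f n * Cprod g n.
Proof. induction n as [|n IH]; simpl; [ring|rewrite IH; ring]. Qed.

Lemma Cprod_neq_0 (f : nat -> C) (n : nat) :
  (forall j, (j < n)%nat -> f j <> 0) -> Cprod f n <> 0.
Proof.
  intros H. induction n as [|n IH]; simpl; [apply C1_nz|].
  apply Cmult_neq_0; [apply IH; intros|]; apply H; lia.
Qed.

Lemma Cprod_exchange (f : nat -> nat -> C) (N n : nat) :
  Cprod (fun m => Cprod (f m) n) N = Cprod (fun j => Cprod (fun m => f m j) N) n.
Proof.
  induction N as [|N IH]; simpl.
  - induction n as [|n IHn]; simpl; [auto|rewrite <- IHn; ring].
  - rewrite IH, <- Cprod_mult. reflexivity.
Qed.

Lemma Clim_Cprod (u : nat -> nat -> C) (l : nat -> C) (n : nat) :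
  (forall j, (j < n)%nat -> Clim (u j) (l j)) ->
  Clim (fun m => Cprod (fun j => u j m) n) (Cprod l n).
Proof.
  intros H. induction n as [|n IH]; simpl; [apply Clim_const|].
  apply Clim_mult; [apply IH; intros|]; apply H; lia.
Qed.

Lemma Cprod_const (c : C) (n : nat) : Cprod (fun _ => c) n = c ^ n.
Proof. induction n as [|n IH]; simpl; [auto|rewrite IH; ring]. Qed.

Lemma Cexp_Csum (f : nat -> C) (n : nat) :
  Cexp (Csum f n) = Cprod (fun j => Cexp (f j)) n.
Proof. induction n as [|n IH]; simpl; [apply Cexp_0|now rewrite Cexp_plus, IH]. Qed.

Lemma Csum_scal (c : C) (f : nat -> C) (n : nat) :
  c * Csum f n = Csum (fun j => c * f j) n.
Proof. induction n as [|n IH]; simpl; [ring|rewrite <- IH; ring]. Qed.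

Lemma Cinv_mult (a b : C) : a <> 0 -> b <> 0 -> / (a * b) = / a * / b.
Proof. intros. field. auto. Qed.

Lemma alt_pow_mult (a b : C) (m : nat) :
  a <> 0 -> b <> 0 -> alt_pow (a * b) m = alt_pow a m * alt_pow b m.
Proof.
  intros. unfold alt_pow. destruct (Nat.even m); [auto|now apply Cinv_mult].
Qed.

Lemma alt_pow_Cprod (f : nat -> C) (n m : nat) :
  (forall j, (j < n)%nat -> f j <> 0) ->
  alt_pow (Cprod f n) m = Cprod (fun j => alt_pow (f j) m) n.
Proof.
  intros H. induction n as [|n IH]; simpl.
  - unfold alt_pow. destruct (Nat.even m); [auto|field].
  - rewrite alt_pow_mult, IH; auto.
    apply Cprod_neq_0; intros; apply H; lia.
Qed.

Lemma Csign_even (m : nat) : (-1) ^ m = if Nat.even m then RtoC 1 else RtoC (-1).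
Proof.
  induction m as [|m IH]; [reflexivity|].
  rewrite Cpow_S, IH, Nat.even_succ, <- Nat.negb_even.
  destruct (Nat.even m); simpl; rewrite <- RtoC_mult; f_equal; ring.
Qed.

Lemma Csign_double (M : nat) : (-1) ^ (2 * M) = 1.
Proof. rewrite Csign_even, Nat.even_even. reflexivity. Qed.

Lemma Cexp_alt_sum (L : nat -> C) (N : nat) :
  Cexp (alt_sum L N) = Cprod (fun m => alt_pow (Cexp (L m)) m) N.
Proof.
  induction N as [|N IH]; [apply Cexp_0|].
  simpl alt_sum. simpl Cprod. rewrite Cexp_plus, IH. f_equal.
  rewrite Csign_even. unfold alt_pow. destruct (Nat.even N).
  - f_equal; ring.
  - rewrite <- Cexp_opp. f_equal; ring.
Qed.

(** Cut at an even index, where the sign of the correction term in [alt_corr] is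
    positive. *)
Definition Wprod (a : nat -> C) (M : nat) : C :=
  Cprod (fun m => alt_pow (a m) m) (2 * M).

Lemma filterlim_double : filterlim (fun M => 2 * M)%nat eventually eventually.
Proof.
  intros P [N HN]. exists N. intros n Hn. apply HN. lia.
Qed.

(** Exponentiating the averaged partial sums turns half of the last logarithm
    into a power of the last index, so the value depends on the numbers
    [e^(L_m)] only, not on the choice of their logarithms. *)
Lemma Clim_Wprod (c : R) (L : nat -> C) (l : C) :
  log_like c L -> is_altsum L l ->
  Clim (fun M => Wprod (fun m => Cexp (L m)) M
    * RtoC (Rpower (INR (S (2 * M))) (c / 2))) (Cexp l).
Proof.
  intros [Hl [K HK]] Ha.
  assert (Hd : Clim (Cdiff L) 0).
  { apply (Clim_squeeze _ _ (fun m => K * / INR (S m))%R).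
    - intros m. replace (Cdiff L m - 0) with (Cdiff L m) by ring. apply HK.
    - replace (Finite 0) with (Finite (K * 0)) by (f_equal; ring).
      apply is_lim_seq_mult'; [apply is_lim_seq_const|].
      apply is_lim_seq_inv_INR_S. }
  apply (Clim_ext (fun M => Cexp (alt_corr L (2 * M)
    + Cdiff L (2 * M) * / 4
    - (L (2 * M)%nat - RtoC (c * ln (INR (S (2 * M))))) * / 2))).
  - intros M. unfold Wprod, Rpower.
    rewrite <- Cexp_alt_sum, <- Cexp_RtoC, <- Cexp_plus. f_equal.
    unfold alt_corr. rewrite Csign_double.
    replace (c / 2 * ln (INR (S (2 * M))))%R
      with (c * ln (INR (S (2 * M))) * / 2)%R by field.
    rewrite (RtoC_mult _ (/ 2)), RtoC_inv by lra. field.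
  - apply Clim_Cexp.
    replace l with (l + 0 * / 4 - 0 * / 2) at 1 by ring.
    apply Clim_sub; [apply Clim_plus|].
    + apply (Clim_subseq (alt_corr L)); [apply filterlim_double|exact Ha].
    + apply (Clim_subseq (fun m => Cdiff L m * / 4)); [apply filterlim_double|].
      apply Clim_mult; [exact Hd|apply Clim_const].
    + apply (Clim_subseq (fun m => (L m - RtoC (c * ln (INR (S m)))) * / 2));
        [apply filterlim_double|].
      apply Clim_mult; [exact Hl|apply Clim_const].
Qed.

(** [P] is the zeta-regularized alternating product of the [m + z], in the form
    of a limit of renormalized partial products. *)
Definition is_shift_prod (z P : C) : Prop :=
  Clim (fun M => Wprod (fun m => INR m + z) M
    * RtoC (sqrt (INR (S (2 * M))))) P.

Lemma sqrt_Rpower_INR_S (m : nat) :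
  Rpower (INR (S m)) (/ 2) = sqrt (INR (S m)).
Proof. apply Rpower_sqrt. pose proof (INR_S_ge_1 m). lra. Qed.

Lemma Wprod_ext (a b : nat -> C) (M : nat) :
  (forall m, a m = b m) -> Wprod a M = Wprod b M.
Proof. intros H. apply Cprod_ext. intros m _. now rewrite H. Qed.

Lemma alt_pow_neq_0 (b : C) (m : nat) : b <> 0 -> alt_pow b m <> 0.
Proof.
  intros Hb. unfold alt_pow. destruct (Nat.even m); [exact Hb|].
  intros E. apply C1_nz. rewrite <- (Cinv_r b Hb), E. ring.
Qed.

Lemma Wprod_neq_0 (a : nat -> C) (M : nat) :
  (forall m, a m <> 0) -> Wprod a M <> 0.
Proof. intros Ha. apply Cprod_neq_0. intros j _. now apply alt_pow_neq_0. Qed.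

Lemma shift_prod_exists (z : C) :
  (forall k : nat, INR k + z <> 0) ->
  exists P : C, P <> 0 /\ is_shift_prod z P.
Proof.
  intros Hz. pose proof (log_like_Clog_shift z Hz) as HL.
  destruct (log_like_altsum 1 _ ltac:(lra) HL) as [l Hl].
  exists (Cexp l). split; [apply Cexp_neq_0|].
  eapply Clim_ext; [|apply (Clim_Wprod _ _ _ HL Hl)].
  intros M. cbv beta. f_equal.
  - apply Wprod_ext. intros m. apply Cexp_Clog, Hz.
  - f_equal. replace (1 / 2)%R with (/ 2)%R by field. apply sqrt_Rpower_INR_S.
Qed.

(** The regularized product is multiplicative in the sequence, whatever logarithm
    of the product of the factors is used. *)
Lemma alt_zeta_value_shift_prods (n : nat) (z P : nat -> C) (L : nat -> C) :
  (1 <= n)%nat -> log_like (INR n) L ->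
  (forall j, (j < n)%nat -> forall k : nat, INR k + z j <> 0) ->
  (forall m, Cexp (L m) = Cprod (fun j => INR m + z j) n) ->
  (forall j, (j < n)%nat -> is_shift_prod (z j) (P j)) ->
  is_alt_zeta_value (fun m s => Cexp (- s * L m)) (Cprod P n).
Proof.
  intros Hn HL Hz HLz HP.
  assert (Hn' : (0 < INR n)%R) by (apply lt_0_INR; lia).
  destruct (log_like_altsum _ _ (Rlt_le _ _ Hn') HL) as [l Hl].
  replace (Cprod P n) with (Cexp l).
  { destruct HL as [_ [K HK]].
    exact (alt_zeta_value_of_log_growth _ K L l Hn' HK Hl). }
  apply (Clim_unique _ _ _ (Clim_Wprod _ _ _ HL Hl)).
  eapply Clim_ext; [|apply (Clim_Cprod _ _ n HP)].
  intros M. cbv beta. rewrite Cprod_mult, Cprod_const. f_equal.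
  - unfold Wprod. rewrite <- Cprod_exchange. apply Cprod_ext. intros m _.
    rewrite HLz. symmetry. apply alt_pow_Cprod. intros j Hj. now apply Hz.
  - rewrite <- RtoC_pow. f_equal.
    rewrite <- sqrt_Rpower_INR_S, <- Rpower_pow by apply Rpower_pos.
    rewrite Rpower_mult. f_equal. field.
Qed.

(** * Wallis' product *)

Fixpoint wallis (M : nat) : R :=
  match M with
  | O => 1
  | S k => wallis k * (INR (2 * k + 1) / INR (2 * k + 2))
  end%R.

Lemma wallis_pos (M : nat) : (0 < wallis M)%R.
Proof.
  induction M as [|M IH]; simpl wallis; [lra|].
  apply Rmult_lt_0_compat; [auto|].
  apply Rdiv_lt_0_compat; apply lt_0_INR; lia.
Qed.

Definition cos_int (k : nat) : R := RInt (fun t => cos t ^ k)%R 0 (PI / 2).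

Lemma ex_RInt_cos_pow (k : nat) (a b : R) :
  ex_RInt (fun t => cos t ^ k)%R a b.
Proof.
  apply (ex_RInt_continuous (V := R_CompleteNormedModule)). intros t _.
  apply (ex_derive_continuous (V := R_NormedModule)). auto_derive. auto.
Qed.

(** Integration of the derivative of [cos^(k+1) sin], which vanishes at both
    ends. *)
Lemma cos_int_rec (k : nat) :
  (INR (k + 2) * cos_int (k + 2) = INR (k + 1) * cos_int k)%R.
Proof.
  pose (g := fun t => (cos t ^ (k + 1) * sin t)%R).
  pose (dg := fun t => (INR (k + 2) * cos t ^ (k + 2) - INR (k + 1) * cos t ^ k)%R).
  assert (H1 : is_RInt dg 0 (PI / 2) (minus (g (PI / 2)%R) (g 0%R))).
  { apply (is_RInt_derive (V := R_CompleteNormedModule) g dg).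
    - intros t _. unfold g, dg. auto_derive; [auto|].
      replace (Init.Nat.pred (k + 1)) with k by lia.
      replace (cos t ^ (k + 2))%R with (cos t ^ k * (1 - (sin t)²))%R.
      + rewrite !plus_INR. simpl INR. replace (k + 1)%nat with (S k) by lia.
        rewrite <- tech_pow_Rmult.
        assert (Hc : (cos t * cos t = 1 - (sin t)²)%R) by (rewrite <- cos2; reflexivity).
        replace (cos t * cos t ^ k * (1 * cos t))%R
          with (cos t ^ k * (cos t * cos t))%R by ring.
        rewrite Hc. unfold Rsqr. ring.
      + rewrite pow_add, <- cos2. unfold Rsqr. ring.
    - intros t _. apply (ex_derive_continuous (V := R_NormedModule)).
      unfold dg. auto_derive. auto. }
  assert (H2 : is_RInt dg 0 (PI / 2)
    (minus (scal (INR (k + 2)) (cos_int (k + 2))) (scal (INR (k + 1)) (cos_int k)))).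
  { apply (is_RInt_minus (V := R_NormedModule));
      apply (is_RInt_scal (V := R_NormedModule));
      apply (RInt_correct (V := R_CompleteNormedModule)), ex_RInt_cos_pow. }
  pose proof (is_RInt_unique _ _ _ _ H1) as E1.
  rewrite (is_RInt_unique _ _ _ _ H2) in E1.
  unfold g, minus, plus, opp, scal in E1. simpl in E1. unfold mult in E1. simpl in E1.
  rewrite cos_PI2, sin_0, pow_i in E1 by lia. lra.
Qed.

Lemma cos_int_decr (k : nat) : (cos_int (S k) <= cos_int k)%R.
Proof.
  pose proof PI_RGT_0.
  apply RInt_le; [lra|apply ex_RInt_cos_pow|apply ex_RInt_cos_pow|].
  intros t Ht. simpl.
  pose proof (COS_bound t).
  assert (0 <= cos t)%R by (apply cos_ge_0; lra).
  pose proof (pow_le (cos t) k H1). nra.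
Qed.

Lemma cos_int_even_odd (M : nat) :
  (cos_int (2 * M) = PI / 2 * wallis M)%R /\
  (cos_int (2 * M + 1) * (INR (2 * M + 1) * wallis M) = 1)%R.
Proof.
  induction M as [|M [IHe IHo]].
  - simpl wallis. simpl Nat.mul. simpl Nat.add. unfold cos_int. split.
    + rewrite (RInt_ext _ (fun _ => 1%R)) by (intros; reflexivity).
      rewrite RInt_const. unfold scal; simpl; unfold mult; simpl. ring.
    + rewrite (RInt_ext _ (Derive sin)).
      * rewrite RInt_Derive; [rewrite sin_0, sin_PI2; simpl; ring| |].
        -- intros. auto_derive. auto.
        -- intros t _. apply (continuous_ext cos).
           ++ intros x. symmetry. apply is_derive_unique, is_derive_Reals, derivable_pt_lim_sin.
           ++ apply (ex_derive_continuous (V := R_NormedModule)). auto_derive. auto.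
      * intros t _. rewrite pow_1. symmetry. apply is_derive_unique, is_derive_Reals, derivable_pt_lim_sin.
  - pose proof (cos_int_rec (2 * M)) as He.
    pose proof (cos_int_rec (2 * M + 1)) as Ho.
    replace (2 * S M)%nat with (2 * M + 2)%nat by lia.
    replace (2 * M + 2 + 1)%nat with (2 * M + 1 + 2)%nat by lia.
    replace (2 * M + 1 + 1)%nat with (2 * M + 2)%nat in Ho by lia.
    simpl wallis. replace (M + (M + 0))%nat with (2 * M)%nat by lia.
    assert (0 < INR (2 * M + 2))%R by (apply lt_0_INR; lia).
    assert (0 < INR (2 * M + 1))%R by (apply lt_0_INR; lia).
    split.
    + apply Rmult_eq_reg_l with (INR (2 * M + 2)); [|lra].
      rewrite He, IHe. field. lra.
    + rewrite <- IHo at 1.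
      replace (cos_int (2 * M + 1 + 2) * (INR (2 * M + 1 + 2)
        * (wallis M * (INR (2 * M + 1) / INR (2 * M + 2)))))%R
        with ((INR (2 * M + 1 + 2) * cos_int (2 * M + 1 + 2))
          * (wallis M * (INR (2 * M + 1) / INR (2 * M + 2))))%R by ring.
      rewrite Ho. field. lra.
Qed.

(** From the monotonicity of [cos_int k] in [k], at [k = 2M, 2M+1, 2M+2]. *)
Lemma wallis_bounds (M : nat) :
  (2 / PI <= INR (2 * M + 1) * wallis M ^ 2
    <= 2 / PI * (1 + / INR (2 * M + 1)))%R.
Proof.
  destruct (cos_int_even_odd M) as [He Ho].
  pose proof (cos_int_rec (2 * M)) as Hr.
  pose proof (cos_int_decr (2 * M)) as H1.
  pose proof (cos_int_decr (2 * M + 1)) as H2.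
  replace (S (2 * M)) with (2 * M + 1)%nat in H1 by lia.
  replace (S (2 * M + 1)) with (2 * M + 2)%nat in H2 by lia.
  pose proof (wallis_pos M) as Hw.
  replace (INR (2 * M + 2)) with (INR (2 * M + 1) + 1)%R in Hr
    by (rewrite !plus_INR; simpl; ring).
  assert (Hx : (0 < INR (2 * M + 1))%R) by (apply lt_0_INR; lia).
  set (x := INR (2 * M + 1)) in *. set (w := wallis M) in *.
  rewrite He in *. pose proof PI_RGT_0 as Hp.
  assert (Hxw : (0 < x * w)%R) by nra.
  split.
  - apply Rmult_le_reg_r with PI; [auto|].
    replace (2 / PI * PI)%R with 2%R by (field; lra). nra.
  - apply Rmult_le_reg_r with (PI * x / 2)%R; [nra|].
    replace (2 / PI * (1 + / x) * (PI * x / 2))%R with (x + 1)%R by (field; lra).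
    assert (Hq : (x * (PI / 2 * w) <= (x + 1) * cos_int (2 * M + 1))%R).
    { rewrite <- Hr. apply Rmult_le_compat_l; lra. }
    apply (Rmult_le_compat_r (x * w)) in Hq; [|lra].
    replace ((x + 1) * cos_int (2 * M + 1) * (x * w))%R with (x + 1)%R in Hq
      by (rewrite Rmult_assoc, Ho; ring).
    nra.
Qed.

Lemma is_lim_seq_inv_odd : is_lim_seq (fun M => / INR (2 * M + 1))%R 0%R.
Proof.
  apply (is_lim_seq_ext (fun M => / INR (S (2 * M)))%R).
  { intros M. do 2 f_equal. lia. }
  apply (is_lim_seq_subseq (fun m => / INR (S m))%R _ (fun M => 2 * M)%nat);
    [apply filterlim_double|].
  apply is_lim_seq_inv_INR_S.
Qed.

Lemma wallis_lim :
  is_lim_seq (fun M => wallis M * sqrt (INR (2 * M + 1)))%R (sqrt (2 / PI)).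
Proof.
  apply (is_lim_seq_ext (fun M => sqrt (INR (2 * M + 1) * wallis M ^ 2))%R).
  { intros M. rewrite sqrt_mult_alt by apply pos_INR.
    rewrite sqrt_pow2 by (left; apply wallis_pos). ring. }
  apply (is_lim_seq_continuous sqrt).
  { apply continuity_pt_sqrt. left. apply Rdiv_lt_0_compat; [lra|apply PI_RGT_0]. }
  apply (is_lim_seq_le_le (fun _ => 2 / PI)%R _
    (fun M => 2 / PI * (1 + / INR (2 * M + 1)))%R _ wallis_bounds).
  - apply is_lim_seq_const.
  - replace (Finite (2 / PI)) with (Finite (2 / PI * (1 + 0))) by (f_equal; ring).
    apply is_lim_seq_mult'; [apply is_lim_seq_const|].
    apply is_lim_seq_plus'; [apply is_lim_seq_const|apply is_lim_seq_inv_odd].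
Qed.

Lemma Cprod_even_step (f : nat -> C) (M : nat) :
  Cprod f (2 * S M) = Cprod f (2 * M) * f (2 * M)%nat * f (S (2 * M)).
Proof. replace (2 * S M)%nat with (S (S (2 * M))) by lia. reflexivity. Qed.

Lemma alt_pow_even (b : C) (M : nat) : alt_pow b (2 * M) = b.
Proof. unfold alt_pow. now rewrite Nat.even_even. Qed.

Lemma alt_pow_odd (b : C) (M : nat) : alt_pow b (S (2 * M)) = / b.
Proof.
  unfold alt_pow. rewrite Nat.even_succ, <- Nat.negb_even, Nat.even_even.
  reflexivity.
Qed.

Lemma RtoC_neq_0 (x : R) : x <> 0%R -> RtoC x <> 0.
Proof. intros H E. apply H. now apply RtoC_inj. Qed.

Lemma sqrt_2_div_PI_neq_0 : RtoC (sqrt (2 / PI)) <> 0.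
Proof.
  apply RtoC_neq_0, Rgt_not_eq, sqrt_lt_R0, Rdiv_lt_0_compat;
    [lra|apply PI_RGT_0].
Qed.

Lemma shift_prod_1 : is_shift_prod 1 (RtoC (sqrt (2 / PI))).
Proof.
  eapply Clim_ext; [|apply Clim_RtoC, wallis_lim].
  intros M. cbv beta. rewrite RtoC_mult.
  replace (2 * M + 1)%nat with (S (2 * M)) by lia. f_equal.
  unfold Wprod. induction M as [|M IH]; [reflexivity|].
  rewrite Cprod_even_step, <- IH, alt_pow_even, alt_pow_odd.
  simpl wallis. replace (M + (M + 0))%nat with (2 * M)%nat by lia.
  assert (INR (2 * M + 2) <> 0)%R by (apply not_0_INR; lia).
  rewrite RtoC_mult, RtoC_div, <- Cmult_assoc by auto. f_equal.
  unfold Cdiv. f_equal; [|f_equal]; rewrite <- RtoC_plus; f_equal;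
    rewrite ?S_INR, ?plus_INR, ?mult_INR; simpl; ring.
Qed.

(** * The alternating harmonic series *)

Fixpoint harmonic (N : nat) : R :=
  match N with
  | O => 0
  | S k => harmonic k + / INR (S k)
  end%R.

Lemma ln_step_bounds (x : R) : (0 < x)%R ->
  (ln (x + 2) - ln (x + 1) <= / (x + 1) <= ln (x + 1) - ln x)%R.
Proof.
  intros Hx.
  assert (H1 : (0 < / (x + 1))%R) by (apply Rinv_0_lt_compat; lra).
  split.
  - rewrite <- ln_div by lra.
    pose proof (exp_ineq1_le (ln ((x + 2) / (x + 1)))) as H.
    rewrite exp_ln in H by (apply Rdiv_lt_0_compat; lra).
    replace ((x + 2) / (x + 1))%R with (1 + / (x + 1))%R in * by (field; lra). lra.
  - rewrite <- (Ropp_involutive (ln (x + 1) - ln x)).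
    replace (- (ln (x + 1) - ln x))%R with (ln x - ln (x + 1))%R by ring.
    rewrite <- ln_div by lra.
    pose proof (exp_ineq1_le (ln (x / (x + 1)))) as H.
    rewrite exp_ln in H by (apply Rdiv_lt_0_compat; lra).
    replace (x / (x + 1))%R with (1 - / (x + 1))%R in * by (field; lra). lra.
Qed.

(** Comparison of [1/(M+1) + ... + 1/(M+j)] with two integrals of [1/t]. *)
Lemma harmonic_sub_bounds (M j : nat) : (1 <= M)%nat ->
  (ln (INR (M + j + 1)) - ln (INR (M + 1)) <= harmonic (M + j) - harmonic M
    <= ln (INR (M + j)) - ln (INR M))%R.
Proof.
  intros HM. induction j as [|j IH].
  - rewrite !Nat.add_0_r. lra.
  - pose proof (ln_step_bounds (INR (M + j))) as H.
    specialize (H ltac:(apply lt_0_INR; lia)).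
    replace (M + S j)%nat with (S (M + j)) by lia.
    change (harmonic (S (M + j))) with (harmonic (M + j) + / INR (S (M + j)))%R.
    replace (INR (S (M + j) + 1)) with (INR (M + j) + 2)%R
      by (rewrite (plus_INR _ 1), S_INR; simpl; ring).
    rewrite (plus_INR (M + j) 1) in IH. simpl (INR 1) in IH.
    rewrite S_INR. lra.
Qed.

Lemma alt_harmonic_lim :
  is_lim_seq (fun M => harmonic (2 * M) - harmonic M)%R (ln 2).
Proof.
  apply is_lim_seq_incr_1.
  apply (is_lim_seq_le_le
    (fun M => ln (2 - / INR (S (S M))))%R _ (fun _ => ln 2)).
  - intros M. pose proof (harmonic_sub_bounds (S M) (S M) ltac:(lia)) as [H1 H2].
    replace (S M + S M)%nat with (2 * S M)%nat in * by lia.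
    rewrite <- ln_div in H1, H2 by (apply lt_0_INR; lia).
    assert (Hp : (0 < INR (S M))%R) by (apply lt_0_INR; lia).
    assert (E1 : (INR (2 * S M + 1) / INR (S M + 1) = 2 - / INR (S (S M)))%R).
    { replace (S M + 1)%nat with (S (S M)) by lia.
      rewrite plus_INR, mult_INR, (S_INR (S M)). simpl (INR 2). simpl (INR 1).
      field. lra. }
    assert (E2 : (INR (2 * S M) / INR (S M) = 2)%R).
    { rewrite mult_INR. simpl (INR 2). field. lra. }
    rewrite E1 in H1. rewrite E2 in H2. split; assumption.
  - apply (is_lim_seq_continuous ln (fun M => 2 - / INR (S (S M)))%R).
    { apply derivable_continuous_pt. exists (/ 2)%R.
      apply derivable_pt_lim_ln. lra. }
    replace (Finite 2) with (Finite (2 - 0)) by (f_equal; ring).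
    apply is_lim_seq_minus'; [apply is_lim_seq_const|].
    apply (is_lim_seq_incr_1 (fun M => / INR (S M))%R).
    apply is_lim_seq_inv_INR_S.
  - apply is_lim_seq_const.
Qed.

Lemma alt_sum_scal (c : C) (u : nat -> C) (N : nat) :
  alt_sum (fun m => c * u m) N = c * alt_sum u N.
Proof. induction N as [|N IH]; simpl; [ring|rewrite IH; ring]. Qed.

(** Catalan's identity
    [1 - 1/2 + ... - 1/(2M) = 1/(M+1) + ... + 1/(2M)]. *)
Lemma alt_sum_inv (M : nat) :
  alt_sum (fun k => RtoC (/ INR (S k))) (2 * M)
  = RtoC (harmonic (2 * M) - harmonic M).
Proof.
  induction M as [|M IH].
  - simpl. f_equal. ring.
  - replace (2 * S M)%nat with (S (S (2 * M))) by lia.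
    change (alt_sum (fun k => RtoC (/ INR (S k))) (S (S (2 * M))))
      with (alt_sum (fun k => RtoC (/ INR (S k))) (2 * M)
        + (-1) ^ (2 * M) * RtoC (/ INR (S (2 * M)))
        + (-1) ^ (S (2 * M)) * RtoC (/ INR (S (S (2 * M))))).
    rewrite IH, Cpow_S, Csign_double, Cmult_1_l, Cmult_1_r, <- RtoC_mult,
      <- !RtoC_plus.
    f_equal.
    change (harmonic (S (S (2 * M)))) with
      (harmonic (2 * M) + / INR (S (2 * M)) + / INR (S (S (2 * M))))%R.
    change (harmonic (S M)) with (harmonic M + / INR (S M))%R.
    rewrite !S_INR, !mult_INR. simpl (INR 2). pose proof (pos_INR M).
    field. lra.
Qed.

(** * The modified gamma function *)

Lemma Clim_inv (u : nat -> C) (l : C) :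
  l <> 0 -> Clim u l -> Clim (fun n => / u n) (/ l).
Proof.
  intros Hl Hu. pose proof (proj1 (Cmod_gt_0 l) Hl) as Hp.
  set (b := fun n => (Cmod (u n - l) * (2 / (Cmod l * Cmod l)))%R).
  assert (Hb : is_lim_seq b 0%R).
  { replace (Finite 0) with (Finite (0 * (2 / (Cmod l * Cmod l)))) by (f_equal; ring).
    apply is_lim_seq_mult'; [exact Hu|apply is_lim_seq_const]. }
  apply (is_lim_seq_le_le_loc (fun _ => 0%R) _ b); [|apply is_lim_seq_const|exact Hb].
  apply is_lim_seq_spec in Hu.
  assert (Hh : (0 < Cmod l / 2)%R) by lra.
  destruct (Hu (mkposreal _ Hh)) as [N HN]. exists N. intros n Hn.
  specialize (HN n Hn). simpl in HN.
  rewrite Rminus_0_r, Rabs_pos_eq in HN by apply Cmod_ge_0.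
  split; [apply Cmod_ge_0|].
  assert (Hun : (Cmod l / 2 < Cmod (u n))%R).
  { pose proof (Cmod_triangle (u n) (l - u n)) as H.
    replace (u n + (l - u n)) with l in H by ring.
    rewrite (Cmod_sub_swap l) in H. lra. }
  assert (Hu0 : u n <> 0) by (apply Cmod_gt_0; lra).
  replace (/ u n - / l) with (- (u n - l) * / (u n * l)) by (field; auto).
  rewrite Cmod_mult, Cmod_opp, Cmod_inv, Cmod_mult by (now apply Cmult_neq_0).
  unfold b. apply Rmult_le_compat_l; [apply Cmod_ge_0|].
  replace (2 / (Cmod l * Cmod l))%R with (/ (Cmod l / 2 * Cmod l))%R by (field; lra).
  apply Rinv_le_contravar; [nra|]. apply Rmult_le_compat_r; lra.
Qed.

Lemma Clim_inv_INR_S : Clim (fun m => RtoC (/ INR (S m))) 0.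
Proof.
  apply (Clim_RtoC _ 0).
  apply is_lim_seq_inv_INR_S.
Qed.

Lemma INR_S_neq_0 (k : nat) : RtoC (INR (S k)) <> 0.
Proof. apply RtoC_neq_0, not_0_INR. lia. Qed.

Definition gamma_factor (x : C) (k : nat) : C :=
  Cexp (- (x / INR (S k))) * (1 + x / INR (S k)).

(** Shifting the index by one inverts an alternating product, up to its first and
    last factors. *)
Lemma shifted_Cprod (x : C) (M : nat) :
  (forall k : nat, INR k + x <> 0) ->
  Cprod (fun k => alt_pow (INR (S k) + x) k) (2 * M)
  = x * / (Wprod (fun m => INR m + x) M * (INR (2 * M) + x)).
Proof.
  intros Hx.
  assert (Hx0 : x <> 0) by (specialize (Hx O); now rewrite Cplus_0_l in Hx).
  induction M as [|M IH].
  - unfold Wprod. simpl. rewrite Cplus_0_l. field. exact Hx0.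
  - assert (HW : Wprod (fun m => INR m + x) M <> 0).
    { apply Wprod_neq_0, Hx. }
    unfold Wprod in *. rewrite !Cprod_even_step, IH, !alt_pow_even, !alt_pow_odd.
    replace (2 * S M)%nat with (S (S (2 * M))) by lia.
    field. repeat split; auto; apply Hx.
Qed.

(** Writing [1 + x/k = (k + x) / k], the product splits into those of the
    exponentials, of the [k + x] and of the [k]; the square roots are inserted so
    that the last two become the renormalized products whose limits are known,
    at the cost of the quotient
    [(2M + x) / (2M + 1) = 1 + (x - 1) / (2M + 1)]. *)
Lemma gamma_Cprod_even (x : C) (M : nat) :
  (forall k : nat, INR k + x <> 0) ->
  Cprod (fun k => alt_pow (gamma_factor x k) k) (2 * M)
  = Cexp (- x * RtoC (harmonic (2 * M) - harmonic M))
    * (x * / ((Wprod (fun m => INR m + x) M * RtoC (sqrt (INR (S (2 * M)))))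
              * (Wprod (fun m => INR m + 1) M * RtoC (sqrt (INR (S (2 * M)))))
              * (1 + (x - 1) * RtoC (/ INR (S (2 * M)))))).
Proof.
  intros Hx.
  assert (HN : forall k : nat, INR k + 1 <> 0).
  { intros k. rewrite <- RtoC_plus, <- S_INR. apply INR_S_neq_0. }
  rewrite <- alt_sum_inv, <- alt_sum_scal, Cexp_alt_sum.
  assert (E : Cprod (fun k => alt_pow (INR (S k) + x) k) (2 * M)
    = Cprod (fun k => alt_pow (1 + x / INR (S k)) k) (2 * M)
      * Wprod (fun m => INR m + 1) M).
  { unfold Wprod. rewrite <- Cprod_mult. apply Cprod_ext. intros k _.
    pose proof (INR_S_neq_0 k) as Hk. pose proof (Hx (S k)) as Hxk.
    rewrite <- alt_pow_mult; [| |apply HN].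
    - f_equal. rewrite <- RtoC_plus, <- S_INR. field. exact Hk.
    - intros E. apply Hxk.
      replace (INR (S k) + x) with (INR (S k) * (1 + x / INR (S k)))
        by (field; exact Hk).
      rewrite E. ring. }
  assert (E2 : Cprod (fun k => alt_pow (gamma_factor x k) k) (2 * M)
    = Cprod (fun m => alt_pow (Cexp (- x * RtoC (/ INR (S m)))) m) (2 * M)
      * Cprod (fun k => alt_pow (1 + x / INR (S k)) k) (2 * M)).
  { rewrite <- Cprod_mult. apply Cprod_ext. intros k _.
    pose proof (INR_S_neq_0 k) as Hk. pose proof (Hx (S k)) as Hxk.
    unfold gamma_factor. rewrite alt_pow_mult; [| apply Cexp_neq_0|].
    - do 3 f_equal. rewrite RtoC_inv by (apply not_0_INR; lia). field. exact Hk.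
    - intros E'. apply Hxk.
      replace (INR (S k) + x) with (INR (S k) * (1 + x / INR (S k)))
        by (field; exact Hk).
      rewrite E'. ring. }
  rewrite E2. f_equal.
  pose proof (Wprod_neq_0 _ M Hx) as HWx. pose proof (Wprod_neq_0 _ M HN) as HW1.
  rewrite (shifted_Cprod x M Hx) in E.
  set (A := Wprod (fun m => INR m + x) M) in *.
  set (B := Wprod (fun m => INR m + 1) M) in *.
  pose proof (Hx (2 * M)%nat) as HxM.
  pose proof (INR_S_neq_0 (2 * M)) as HS.
  assert (Hq : RtoC (sqrt (INR (S (2 * M)))) * RtoC (sqrt (INR (S (2 * M))))
    = INR (S (2 * M))).
  { rewrite <- RtoC_mult, sqrt_sqrt; [reflexivity|apply pos_INR]. }
  rewrite RtoC_inv by (apply not_0_INR; lia).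
  replace (A * sqrt (INR (S (2 * M))) * (B * sqrt (INR (S (2 * M))))
    * (1 + (x - 1) * / INR (S (2 * M))))
    with (A * B * (INR (S (2 * M)) * (1 + (x - 1) * / INR (S (2 * M)))))
    by (rewrite <- Hq at 1; ring).
  replace (INR (S (2 * M)) * (1 + (x - 1) * / INR (S (2 * M))))
    with (INR (2 * M) + x).
  2:{ transitivity (INR (S (2 * M)) + (x - 1)); [|field; exact HS].
      rewrite S_INR, RtoC_plus. ring. }
  apply (f_equal (fun t => t * / B)) in E.
  replace (Cprod (fun k => alt_pow (1 + x / INR (S k)) k) (2 * M) * B * / B)
    with (Cprod (fun k => alt_pow (1 + x / INR (S k)) k) (2 * M)) in E
    by (field; exact HW1).
  rewrite <- E. field. auto.
Qed.

Lemma Clim_gamma_Cprod (x P : C) :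
  (forall k : nat, INR k + x <> 0) ->
  P <> 0 -> is_shift_prod x P ->
  Clim (Cprod (fun k => alt_pow (gamma_factor x k) k))
    (Cexp (- x * RtoC (ln 2)) * (x * / (P * RtoC (sqrt (2 / PI))))).
Proof.
  intros Hx HP0 HP.
  pose proof sqrt_2_div_PI_neq_0 as HQ.
  assert (He : Clim (fun M => Cprod (fun k => alt_pow (gamma_factor x k) k) (2 * M))
    (Cexp (- x * RtoC (ln 2)) * (x * / (P * RtoC (sqrt (2 / PI)))))).
  { eapply Clim_ext; [intros M; symmetry; now apply gamma_Cprod_even|].
    apply Clim_mult.
    - apply Clim_Cexp, Clim_scal, Clim_RtoC, alt_harmonic_lim.
    - apply Clim_scal, Clim_inv; [now apply Cmult_neq_0|].
      replace (P * RtoC (sqrt (2 / PI)))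
        with (P * RtoC (sqrt (2 / PI)) * (1 + (x - 1) * 0)) by ring.
      apply Clim_mult; [apply Clim_mult; [exact HP|exact shift_prod_1]|].
      apply Clim_plus; [apply Clim_const|]. apply Clim_scal.
      exact (Clim_subseq _ _ _ filterlim_double Clim_inv_INR_S). }
  apply Clim_even_odd; [exact He|].
  apply (Clim_ext (fun M => Cprod (fun k => alt_pow (gamma_factor x k) k) (2 * M)
    * gamma_factor x (2 * M))).
  { intros M. rewrite <- (alt_pow_even (gamma_factor x (2 * M)) M). reflexivity. }
  match goal with |- Clim _ ?l => replace l with (l * 1) by ring end.
  apply Clim_mult; [exact He|].
  apply (Clim_subseq (gamma_factor x) 1 _ filterlim_double).
  apply (Clim_ext (fun k => Cexp (- x * RtoC (/ INR (S k)))
    * (1 + x * RtoC (/ INR (S k))))).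
  { intros k. unfold gamma_factor. rewrite RtoC_inv by (apply not_0_INR; lia).
    pose proof (INR_S_neq_0 k). f_equal; f_equal; field; auto. }
  match goal with |- Clim ?u _ =>
    cut (Clim u (Cexp (- x * 0) * (1 + x * 0))) end.
  { now rewrite !Cmult_0_r, Cexp_0, Cplus_0_r, Cmult_1_l. }
  apply Clim_mult; [apply Clim_Cexp|apply Clim_plus; [apply Clim_const|]];
    apply Clim_scal, Clim_inv_INR_S.
Qed.

Lemma Cinf_prod_eq (f : nat -> C) (p : C) :
  Clim (Cprod f) p -> Cinf_prod f = p.
Proof.
  intros H. unfold Cinf_prod.
  apply (iota_filterlim_locally (V := C_CompleteNormedModule)).
  now apply Clim_filterlim.
Qed.

(** The limit of the partial products is known, so the convergence of the product
    defining [mGamma] is obtained at the same time as its value. *)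
Lemma mGamma_eq (x P : C) :
  (forall k : nat, INR k + x <> 0) ->
  P <> 0 -> is_shift_prod x P -> mGamma x = / (P * RtoC (sqrt (2 / PI))).
Proof.
  intros Hx HP0 HP. unfold mGamma.
  assert (Hx0 : x <> 0) by (specialize (Hx O); now rewrite Cplus_0_l in Hx).
  change (Cinf_prod _)
    with (Cinf_prod (fun k => alt_pow (gamma_factor x k) k)).
  rewrite (Cinf_prod_eq _ _ (Clim_gamma_Cprod x P Hx HP0 HP)).
  replace (- x * RtoC (ln 2)) with (- (x * RtoC (ln 2))) by ring.
  rewrite Cexp_opp.
  pose proof sqrt_2_div_PI_neq_0 as HQ.
  field. repeat split; auto using Cexp_neq_0.
Qed.

Lemma shift_prod_mGamma (x : C) :
  (forall k : nat, INR k + x <> 0) ->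
  is_shift_prod x (RtoC (sqrt (PI / 2)) / mGamma x).
Proof.
  intros Hx. destruct (shift_prod_exists x Hx) as [P [HP0 HP]].
  rewrite (mGamma_eq x P Hx HP0 HP).
  assert (Hs : (0 < sqrt (2 / PI))%R).
  { apply sqrt_lt_R0, Rdiv_lt_0_compat; [lra|apply PI_RGT_0]. }
  assert (HQ : RtoC (sqrt (2 / PI)) <> 0) by (apply RtoC_neq_0; lra).
  replace (RtoC (sqrt (PI / 2)) / / (P * RtoC (sqrt (2 / PI)))) with P; [exact HP|].
  replace (sqrt (PI / 2)) with (/ sqrt (2 / PI))%R.
  - rewrite RtoC_inv by lra. field. auto.
  - rewrite <- sqrt_inv. f_equal. field. apply PI_neq0.
Qed.

(** * Roots of unity *)

(** The Horner form makes synthetic division a structural induction; equality is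
    pointwise, so that polynomials can be identified with functions. *)
Fixpoint monic (n : nat) (f : C -> C) : Prop :=
  match n with
  | O => forall w, f w = 1
  | S k => exists g c, monic k g /\ forall w, f w = w * g w + c
  end.

Lemma monic_add_const (n : nat) (f : C -> C) (c : C) :
  monic (S n) f -> monic (S n) (fun w => f w + c).
Proof.
  intros (g & d & Hg & Hf). exists g, (d + c). split; [auto|].
  intros w. rewrite Hf. ring.
Qed.

Lemma monic_pow (n : nat) : monic n (fun w => w ^ n).
Proof.
  induction n as [|n IH]; [intros w; reflexivity|].
  exists (fun w => w ^ n), 0. split; [auto|]. intros w. rewrite Cpow_S. ring.
Qed.

(** Synthetic division by [w - r]. *)
Lemma monic_factor (n : nat) (f : C -> C) (r : C) :
  monic (S n) f -> f r = 0 ->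
  exists g, monic n g /\ forall w, f w = (w - r) * g w.
Proof.
  revert f. induction n as [|n IH]; intros f (g & c & Hg & Hf) Hr;
    rewrite Hf in Hr.
  - exists g. split; [auto|]. intros w. simpl in Hg.
    rewrite Hf, Hg. rewrite Hg in Hr.
    replace c with (r * 1 + c - r) by ring. rewrite Hr. ring.
  - destruct (IH _ (monic_add_const _ _ (- g r) Hg)) as (q & Hq & Hgq); [ring|].
    exists (fun w => w * q w + g r). split.
    + now exists q, (g r).
    + intros w. rewrite Hf.
      replace c with (r * g r + c - r * g r) by ring. rewrite Hr.
      replace (g w) with ((g w + - g r) + g r) by ring. rewrite Hgq. ring.
Qed.

Lemma monic_eq_Cprod_roots (n : nat) (f : C -> C) (r : nat -> C) :
  monic n f ->
  (forall i j, (i < j < n)%nat -> r i <> r j) ->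
  (forall j, (j < n)%nat -> f (r j) = 0) ->
  forall w, f w = Cprod (fun j => w - r j) n.
Proof.
  revert f. induction n as [|n IH]; intros f Hf Hd Hr w; [apply Hf|].
  destruct (monic_factor n f (r n) Hf) as (g & Hg & Hfg); [apply Hr; lia|].
  rewrite Hfg. simpl. rewrite <- (IH g Hg).
  - ring.
  - intros i j Hij. apply Hd. lia.
  - intros j Hj. specialize (Hr j ltac:(lia)). rewrite Hfg in Hr.
    assert (Hn : r j - r n <> 0) by (apply Cminus_eq_contra, Hd; lia).
    replace (g (r j)) with (/ (r j - r n) * ((r j - r n) * g (r j)))
      by (field; exact Hn).
    rewrite Hr. ring.
Qed.

Lemma zeta_root_pow (n k : nat) : (1 <= n)%nat ->
  zeta_root n ^ k
  = (cos (2 * (PI * (INR k / INR n))), sin (2 * (PI * (INR k / INR n))))%R.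
Proof.
  intros Hn. assert (HN : INR n <> 0%R) by (apply not_0_INR; lia).
  unfold zeta_root. rewrite <- Cexp_nat_mult.
  replace (INR k * (2 * PI * Ci / INR n))
    with ((0, 2 * (PI * (INR k / INR n)))%R : C).
  - unfold Cexp. simpl. rewrite exp_0, !Rmult_1_l. reflexivity.
  - rewrite <- RtoC_mult. unfold Cdiv. rewrite <- RtoC_inv by exact HN.
    apply injective_projections; simpl; field; exact HN.
Qed.

Lemma zeta_root_pow_n (n : nat) : (1 <= n)%nat -> zeta_root n ^ n = 1.
Proof.
  intros Hn. assert (HN : INR n <> 0%R) by (apply not_0_INR; lia).
  rewrite zeta_root_pow by exact Hn.
  replace (2 * (PI * (INR n / INR n)))%R with (2 * PI)%R by (field; exact HN).
  now rewrite cos_2PI, sin_2PI.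
Qed.

Lemma zeta_root_pow_neq_1 (n k : nat) :
  (0 < k < n)%nat -> zeta_root n ^ k <> 1.
Proof.
  intros Hk E. rewrite zeta_root_pow in E by lia.
  apply (f_equal Re) in E. simpl in E.
  set (t := (PI * (INR k / INR n))%R) in *.
  assert (Ht : (0 < t < PI)%R).
  { pose proof PI_RGT_0.
    assert (0 < INR k)%R by (apply lt_0_INR; lia).
    assert (INR k < INR n)%R by (apply lt_INR; lia).
    assert (0 < INR k / INR n < 1)%R.
    { split; [apply Rdiv_lt_0_compat; lra|].
      apply Rmult_lt_reg_r with (INR n); [lra|].
      unfold Rdiv. rewrite Rmult_assoc, Rinv_l; lra. }
    unfold t. nra. }
  pose proof (sin_gt_0 t (proj1 Ht) (proj2 Ht)).
  rewrite cos_2a_sin in E. nra.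
Qed.

Lemma zeta_root_pow_inj (n i j : nat) :
  (i < j < n)%nat -> zeta_root n ^ i <> zeta_root n ^ j.
Proof.
  intros Hij E. apply (zeta_root_pow_neq_1 n (j - i)); [lia|].
  replace j with (i + (j - i))%nat in E by lia.
  rewrite Cpow_add_r in E.
  assert (Hi : zeta_root n ^ i <> 0) by (apply Cpow_nz, Cexp_neq_0).
  replace (zeta_root n ^ (j - i))
    with (/ zeta_root n ^ i * (zeta_root n ^ i * zeta_root n ^ (j - i)))
    by (field; exact Hi).
  rewrite <- E. field. exact Hi.
Qed.

(** For [y <> 0] the [zeta^j y] are [n] distinct roots of a monic polynomial of
    degree [n] in [w]; for [y = 0] they coincide, but both sides are [w^n]. *)
Lemma pow_sub_pow_factor (n : nat) (w y : C) : (1 <= n)%nat ->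
  w ^ n - y ^ n = Cprod (fun j => w - zeta_root n ^ j * y) n.
Proof.
  intros Hn. destruct (Ceq_dec y 0) as [->|Hy].
  - rewrite (Cprod_ext _ (fun _ => w)) by (intros; ring).
    rewrite Cprod_const. destruct n; [lia|]. rewrite (Cpow_S 0). ring.
  - destruct n as [|n]; [lia|].
    apply (monic_eq_Cprod_roots (S n) (fun w => w ^ S n - y ^ S n)
      (fun j => zeta_root (S n) ^ j * y)).
    + apply (monic_add_const n (fun w => w ^ S n)), monic_pow.
    + intros i j Hij E. apply (zeta_root_pow_inj _ _ _ Hij).
      replace (zeta_root (S n) ^ i) with (zeta_root (S n) ^ i * y * / y)
        by (field; exact Hy).
      rewrite E. field. exact Hy.
    + intros j _.
      rewrite Cpow_mult_l, <- Cpow_mult_r, Nat.mul_comm, Cpow_mult_r,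
        zeta_root_pow_n, Cpow_1_l by exact Hn.
      ring.
Qed.

(** * Products of differences of n-th powers *)

Lemma is_alt_zeta_value_ext (p q : nat -> C -> C) (P : C) :
  (forall m s, p m s = q m s) -> is_alt_zeta_value p P -> is_alt_zeta_value q P.
Proof.
  intros H (F & eps & d & He & Hs & HF & Hd & HP).
  exists F, eps, d. repeat (split; auto). intros s Hs0.
  eapply is_series_ext; [|exact (Hs s Hs0)].
  intros m. cbv beta. now rewrite H.
Qed.

Theorem corollary3p23 (n : nat) (hn : (1 <= n)%nat) (x y : C)
  (hxy : forall j k : nat, (j < n)%nat ->
           (x - zeta_root n ^ j * y <> - INR k)%C) :
  let V := (RtoC (sqrt (PI / 2)) ^ n
            / Cprod (fun j => mGamma (x - zeta_root n ^ j * y)) n)%C in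
  is_alt_zeta_prod (fun m => ((INR m + x) ^ n - y ^ n)%C) V /\
  is_alt_zeta_prod_factored n
    (fun m j => (INR m + x - zeta_root n ^ j * y)%C) V.
Proof.
  set (z := fun j => x - zeta_root n ^ j * y).
  assert (Hz : forall j, (j < n)%nat -> forall k : nat, INR k + z j <> 0).
  { intros j Hj k E. apply (hxy j k Hj). fold (z j).
    replace (z j) with (INR k + z j - INR k) by ring. rewrite E. ring. }
  assert (Hb : forall m j, INR m + x - zeta_root n ^ j * y = INR m + z j)
    by (intros; unfold z; ring).
  assert (Ha : forall m, (INR m + x) ^ n - y ^ n = Cprod (fun j => INR m + z j) n).
  { intros m. rewrite pow_sub_pow_factor by exact hn.
    apply Cprod_ext. intros j _. apply Hb. }
  intros V.
  set (P := fun j => RtoC (sqrt (PI / 2)) / mGamma (z j)).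
  assert (HP : forall j, (j < n)%nat -> is_shift_prod (z j) (P j))
    by (intros j Hj; apply shift_prod_mGamma, Hz, Hj).
  assert (HG : forall j, (j < n)%nat -> mGamma (z j) <> 0).
  { intros j Hj. destruct (shift_prod_exists _ (Hz j Hj)) as [Q [HQ0 HQ]].
    rewrite (mGamma_eq _ Q (Hz j Hj) HQ0 HQ).
    apply (alt_pow_neq_0 _ 1), Cmult_neq_0; [exact HQ0|].
    apply sqrt_2_div_PI_neq_0. }
  assert (HV : Cprod P n = V).
  { unfold V. fold z.
    assert (HN := Cprod_neq_0 (fun j => mGamma (z j)) n HG).
    assert (E : Cprod P n * Cprod (fun j => mGamma (z j)) n
      = RtoC (sqrt (PI / 2)) ^ n).
    { rewrite <- Cprod_mult, <- Cprod_const. apply Cprod_ext. intros j Hj.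
      unfold P. field. now apply HG. }
    change (Cprod (fun j => mGamma (x - zeta_root n ^ j * y)) n)
      with (Cprod (fun j => mGamma (z j)) n).
    rewrite <- E. field. exact HN. }
  set (L := fun m => Csum (fun j => Clog (INR m + z j)) n).
  assert (HL : log_like (INR n) L).
  { apply (log_like_Csum (fun j m => Clog (INR m + z j))).
    intros j Hj. apply log_like_Clog_shift, Hz, Hj. }
  assert (HeL : forall m, Cexp (L m) = Cprod (fun j => INR m + z j) n).
  { intros m. unfold L. rewrite Cexp_Csum. apply Cprod_ext. intros j Hj.
    apply Cexp_Clog, Hz, Hj. }
  rewrite <- HV. split; split.
  - intros m. rewrite Ha. apply Cprod_neq_0. intros j Hj. now apply Hz.
  - apply (is_alt_zeta_value_ext (fun m s => Cexp (- s * Clog (Cexp (L m))))).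
    { intros m s. unfold Cpower. now rewrite HeL, Ha. }
    apply (alt_zeta_value_shift_prods n z); auto.
    + now apply log_like_Clog_Cexp.
    + intros m. rewrite Cexp_Clog by apply Cexp_neq_0. apply HeL.
  - intros m j Hj. rewrite Hb. now apply Hz.
  - apply (is_alt_zeta_value_ext (fun m s => Cexp (- s * L m))).
    { intros m s. unfold L. rewrite Csum_scal, Cexp_Csum.
      apply Cprod_ext. intros j _. unfold Cpower. now rewrite Hb. }
    apply (alt_zeta_value_shift_prods n z); auto.
Qed.
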